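(* Let $\mathfrak{g}$ be a basic simple $\mathbb{Z}_2\times\mathbb{Z}_2$-graded Lie algebra with Cartan subalgebra $\mathfrak{t}$, and let $\Delta\subset\mathfrak{t}^*$ be the set of generalized roots of $\mathfrak{g}$ with respect to $\mathfrak{t}$. Then $\Delta$ is an abstract root system in the real inner product space $\mathfrak{t}_0^*$, a real form of $\mathfrak{t}^*$.
   Context: Everything is over $\mathbb{C}$ and $\mathfrak{g}$ is finite-dimensional. For $a=(a_1,a_2),b=(b_1,b_2)\in\mathbb{Z}_2\times\mathbb{Z}_2$ put $ab:=a_1b_2-a_2b_1\in\mathbb{Z}_2$. A $\mathbb{Z}_2\times\mathbb{Z}_2$-graded Lie algebra is a $\mathbb{Z}_2\times\mathbb{Z}_2$-graded vector space $\mathfrak{g}=\bigoplus_{a}\mathfrak{g}^a$ with a bilinear bracket such that $[\mathfrak{g}^a,\mathfrak{g}^b]\subseteq\mathfrak{g}^{a+b}$; $[x,y]=-(-1)^{ab}[y,x]$ for $x\in\mathfrak{g}^a,y\in\mathfrak{g}^b$; and $[x,[y,z]]=[[x,y],z]+(-1)^{ab}[y,[x,z]]$ for $x\in\mathfrak{g}^a,y\in\mathfrak{g}^b,z\in\mathfrak{g}$. In particular $\mathfrak{g}^{(0,0)}$ is an ordinary Lie algebra. $\mathfrak{g}$ is simple if it is nonzero and has no graded ideals other than $\{0\}$ and $\mathfrak{g}$. The Killing form is $K(x,y)=\mathrm{tr}(\mathrm{ad}\,x\circ\mathrm{ad}\,y)$, where $\mathrm{ad}(x)(y)=[x,y]$.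 $\mathfrak{g}$ is basic if $K$ is nondegenerate and $\mathfrak{g}^{(0,0)}$ is reductive. A Cartan subalgebra $\mathfrak{t}$ of $\mathfrak{g}$ means a Cartan subalgebra of the reductive Lie algebra $\mathfrak{g}^{(0,0)}$. For $\alpha\in\mathfrak{t}^*$ let $\mathfrak{g}_\alpha=\{x\in\mathfrak{g}\mid \forall h\in\mathfrak{t}\ \exists n>0:\ (\mathrm{ad}(h)-\alpha(h)\mathrm{Id})^n x=0\}$; a generalized root is a nonzero $\alpha\in\mathfrak{t}^*$ with $\mathfrak{g}_\alpha\neq\{0\}$, and $\Delta$ is the set of generalized roots. The restriction of $K$ to $\mathfrak{t}$ is nondegenerate; for $\alpha\in\mathfrak{t}^*$ let $H_\alpha\in\mathfrak{t}$ be the unique element with $\alpha(H)=K(H_\alpha,H)$ for all $H\in\mathfrak{t}$, and set $\langle\alpha,\beta\rangle:=K(H_\alpha,H_\beta)$ for $\alpha,\beta\in\mathfrak{t}^*$. Set $\mathfrak{t}_0:=\sum_{\alpha\in\Delta}\mathbb{R}H_\alpha\subset\mathfrak{t}$; it is a real form of $\mathfrak{t}$ on which $K$ is a (real, positive-definite) inner product. $\mathfrak{t}_0^*$ is viewed inside $\mathfrak{t}^*$ as the set of functionals that are real-valued on $\mathfrak{t}_0$, with inner product the restriction of $\langle\cdot,\cdot\rangle$. An abstract root system in a finite-dimensional real inner product space $(E,\langle\cdot,\cdot\rangle)$ is a finite set $\Delta$ of nonzero elements of $E$ such that (i) $\Delta$ spans $E$; (ii) for every $\alpha\in\Delta$,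 the reflection $s_\alpha(\beta)=\beta-2\frac{\langle\beta,\alpha\rangle}{\langle\alpha,\alpha\rangle}\alpha$ maps $\Delta$ to itself; (iii) $2\frac{\langle\beta,\alpha\rangle}{\langle\alpha,\alpha\rangle}\in\mathbb{Z}$ for all $\alpha,\beta\in\Delta$. (It is not required to be reduced.) *)

(* Defs.v *)
From HB Require Import structures.
From mathcomp Require Import all_boot all_order all_algebra.
From mathcomp Require Import all_classical all_reals.
From mathcomp.real_closed Require Import complex.
Set Implicit Arguments. Unset Strict Implicit. Unset Printing Implicit Defensive.
Import Order.TTheory GRing.Theory Num.Theory.
Local Open Scope ring_scope.
Local Open Scope complex_scope.
Local Open Scope classical_set_scope.

Section RestrictionOfScalars.
Variables (R : rcfType) (V : vectType R[i]).

(* V with scalars restricted to R: the alias is convertible to V, so that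
   elements and sets can be moved freely between the two. *)
Definition realification : Type := V.
HB.instance Definition _ := GRing.Zmodule.on realification.

Let rscale (a : R) (v : realification) : realification := a%:C *: (v : V).

Let rscaleA a b v : rscale a (rscale b v) = rscale (a * b) v.
Proof. by rewrite /rscale scalerA rmorphM. Qed.
Let rscale1 : left_id 1 rscale.
Proof. by move=> v; rewrite /rscale rmorph1 scale1r. Qed.
Let rscaleDr : right_distributive rscale +%R.
Proof. by move=> a u v; rewrite /rscale scalerDr. Qed.
Let rscaleDl v : {morph rscale^~ v : a b / a + b}.
Proof. by move=> a b; rewrite /rscale rmorphD scalerDl. Qed.

HB.instance Definition _ := GRing.Zmodule_isLmodule.Build R realification
  rscaleA rscale1 rscaleDr rscaleDl.

Lemma realification_scaleE (a : R) (v : realification) :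
  a *: v = a%:C *: (v : V) :> V.
Proof. by []. Qed.

Import VectorInternalTheory.

Lemma realification_vect_axiom :
  Vector.axiom (dim V + dim V)%N realification.
Proof.
pose f (v : realification) : 'rV[R]_(dim V + dim V) :=
  row_mx (map_mx (@complex.Re R) (v2r (v : V)))
         (map_mx (@complex.Im R) (v2r (v : V))).
pose r (w : 'rV[R]_(dim V + dim V)) : realification :=
  r2v
    (\row_j (lsubmx w 0 j +i* rsubmx w 0 j) : 'rV[R[i]]_(dim V)) : V.
exists f.
  move=> a u v.
  have v2rD : v2r ((a *: u + v : realification) : V) =
      a%:C *: v2r (u : V)
        + v2r (v : V).
    exact: (linearP (@v2r _ V)).
  rewrite /f v2rD scale_row_mx add_row_mx.
  congr row_mx; apply/rowP=> j; rewrite !mxE.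
    by case: (v2r _ _ _) => x y;
      case: (v2r _ _ _) => z t /=; rewrite mul0r subr0.
  by case: (v2r _ _ _) => x y;
    case: (v2r _ _ _) => z t /=; rewrite mul0r addr0.
exists r => [v|w]; rewrite /r /f.
  rewrite -[RHS]v2rK; congr r2v.
  by apply/rowP=> j; rewrite mxE row_mxKl row_mxKr !mxE; case: (_ _ _ j).
rewrite r2vK -[RHS]hsubmxK.
by congr row_mx; apply/rowP=> j; rewrite !mxE.
Qed.
HB.instance Definition _ :=
  Lmodule_hasFinDim.Build R realification realification_vect_axiom.
End RestrictionOfScalars.

Definition real_subspace (R : realType) (V : vectType R) (E : set V) : Prop :=
  E 0 /\ forall (c : R) x y, E x -> E y -> E (c *: x + y).

(* V = E (+) iE as real vector spaces. *)
Definition real_form (R : realType) (V : vectType R[i])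
    (E : set (realification V)) : Prop :=
  real_subspace E /\
  forall v : V, exists! p : V * V,
    [/\ E p.1, E p.2 & v = p.1 + 'i%C *: p.2].

Definition span_set (F : fieldType) (V : vectType F) (S : set V) : set V :=
  [set v | exists s : seq V, (forall u, u \in s -> S u) /\ v \in <<s>>%VS].
Arguments span_set {F} V S _.

(* Only the values of ip on the subspace E matter. *)
Definition real_inner_product_space (R : realType) (V : vectType R)
    (E : set V) (ip : V -> V -> R) : Prop :=
  [/\ real_subspace E,
      forall (c : R) x y z, E x -> E y -> E z ->
        ip (c *: x + y) z = c * ip x z + ip y z,
      forall x y, E x -> E y -> ip x y = ip y x &
      forall x, E x -> x != 0 -> 0 < ip x x].

Definition abstract_root_system (R : realType) (V : vectType R)
    (E : set V) (ip : V -> V -> R) (D : set V) : Prop :=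
  let n b a : R := 2 * (ip b a / ip a a) in
  [/\ finite_set D /\ ~ D 0,
      span_set V D = E,
      forall a b, D a -> D b -> D (b - n b a *: a) &
      forall a b, D a -> D b -> n b a \is a Num.int].

Definition Z2Z2 : Type := ('Z_2 * 'Z_2)%type.
HB.instance Definition _ := GRing.Zmodule.on Z2Z2.
HB.instance Definition _ := Finite.on Z2Z2.

Definition sgn_form (a b : Z2Z2) : 'Z_2 := a.1 * b.2 - a.2 * b.1.

Record gradedLie (K : fieldType) (g : vectType K) := GradedLie {
  homog : Z2Z2 -> {vspace g};
  bracket : {bilinear g -> g -> g};
  homog_sum : (\sum_a homog a)%VS = fullv;
  homog_direct : directv (\sum_a homog a);
  bracket_homog : forall a b x y,
    x \in homog a -> y \in homog b -> bracket x y \in homog (a + b);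
  bracket_sym : forall a b x y, x \in homog a -> y \in homog b ->
    bracket x y = - ((-1) ^+ sgn_form a b *: bracket y x);
  bracket_jacobi : forall a b x y z, x \in homog a -> y \in homog b ->
    bracket x (bracket y z) =
      bracket (bracket x y) z + (-1) ^+ sgn_form a b *: bracket y (bracket x z)
}.

Section GradedLieTheory.
Variables (K : fieldType) (g : vectType K) (L : gradedLie g).
Local Notation "[[ x , y ]]" := (bracket L x y).

Definition graded_subspace (I : {vspace g}) : Prop :=
  I = (\sum_a (I :&: homog L a))%VS.

Definition graded_ideal (I : {vspace g}) : Prop :=
  graded_subspace I /\
  forall x y, y \in I -> [[x, y]] \in I /\ [[y, x]] \in I.

Definition simple_graded : Prop :=
  (fullv : {vspace g}) <> 0%VS /\
  forall I, graded_ideal I -> I = 0%VS \/ I = fullv.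

Definition ad (x : g) : 'End(g) := linfun (bracket L x).

Definition lfun_trace (f : 'End(g)) : K :=
  \sum_i coord (vbasis fullv) i (f (vbasis fullv)`_i).

Definition killing (x y : g) : K := lfun_trace (ad x \o ad y)%VF.

(* The notions below concern the ordinary Lie algebra L_(0,0). *)
Local Notation g0 := (homog L 0).

Definition ideal0 (I : {vspace g}) : Prop :=
  (I <= g0)%VS /\ forall x y, x \in g0 -> y \in I -> [[x, y]] \in I.

Definition reductive0 : Prop :=
  forall I, ideal0 I ->
    exists J, [/\ ideal0 J, (I + J)%VS = g0 & (I :&: J)%VS = 0%VS].

Definition basic : Prop :=
  (forall x, (forall y, killing x y = 0) -> x = 0) /\ reductive0.

Definition bracketv (U V : {vspace g}) : {vspace g} :=
  <<[seq [[u, v]] | u <- vbasis U, v <- vbasis V]>>%VS.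

Definition nilpotentv (U : {vspace g}) : Prop :=
  exists n, iter n (bracketv U) U = 0%VS.

Definition cartan_subalgebra (t : {vspace g}) : Prop :=
  [/\ (t <= g0)%VS,
      (forall x y, x \in t -> y \in t -> [[x, y]] \in t),
      nilpotentv t &
      forall x, x \in g0 -> (forall h, h \in t -> [[x, h]] \in t) -> x \in t].

Variable t : {vspace g}.
Local Notation tdual := 'Hom(subvs_of t, K^o).

Definition root_space (alpha : tdual) : set g :=
  [set x | forall h : subvs_of t, exists n,
     (0 < n)%N /\ iter n (fun y => ad (vsval h) y - alpha h *: y) x = 0].

Definition generalized_roots : set tdual :=
  [set alpha | alpha != 0 /\ exists x, root_space alpha x /\ x != 0].

(* H_alpha, with junk value 0 if no element of t represents alpha; it is the
   unique representative when the Killing form is nondegenerate on t. *)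
Definition dual_vector (alpha : tdual) : subvs_of t :=
  xget 0 [set H | forall H' : subvs_of t,
                    alpha H' = killing (vsval H) (vsval H')].

Definition dual_form (alpha beta : tdual) : K :=
  killing (vsval (dual_vector alpha)) (vsval (dual_vector beta)).

End GradedLieTheory.
Arguments generalized_roots {K g} L t _.

Section RealForms.
Variables (R : realType) (g : vectType R[i]) (L : gradedLie g).
Variable t : {vspace g}.
Local Notation tdual := 'Hom(subvs_of t, R[i]^o).

Definition t0 : set (realification (subvs_of t)) :=
  (* the space is explicit: over subvs_of t the span would be complex *)
  span_set (realification (subvs_of t))
    [set dual_vector L alpha | alpha in generalized_roots L t].

Definition t0_dual : set (realification tdual) :=
  [set phi | forall h : subvs_of t, t0 h -> (phi : tdual) h \is Num.real].

(* Equal to dual_form wherever the latter is real-valued, so an inner product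
   on t0_dual that restricts dual_form requires dual_form to be real there. *)
Definition re_dual_form (alpha beta : realification tdual) : R :=
  complex.Re (dual_form L (alpha : tdual) (beta : tdual)).

End RealForms.
Arguments t0 {R g} L t _.
Arguments t0_dual {R g} L t _.
Arguments re_dual_form {R g} L t _ _.

(* Main.v *)
Require Import Defs.
From HB Require Import structures.
From mathcomp Require Import all_boot all_order all_algebra.
From mathcomp Require Import all_classical all_reals.
From mathcomp.real_closed Require Import complex.
From mathcomp Require Import spectral ring.
Set Implicit Arguments. Unset Strict Implicit. Unset Printing Implicit Defensive.
Import Order.TTheory GRing.Theory Num.Theory.
Import passmx.
Local Open Scope ring_scope.
Local Open Scope complex_scope.
Local Open Scope classical_set_scope.

(** The antisymmetry and Jacobi rules are used only for two elements of the same
    degree or when one element has degree 0. The commutation sign is trivial in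
    both cases, so the structure theory of semisimple Lie algebras can be
    followed, with the nondegenerate Killing form K in place of semisimplicity.

    Let t be the Cartan subalgebra and g0 the component of degree 0. Engel's
    theorem and the Fitting decomposition ([engel_cartan], [cartan_complement])
    show that g0 is t plus the images of high powers of ad h, h in t. Hence K is
    nondegenerate on t ([killing_nondeg_cartan]). The last nonzero term of the
    lower central series of t, if it lies in [t, t], consists of elements u for
    which all positive powers of ad u are traceless; they are orthogonal to t, so
    that t is abelian ([cartan_abelian]). For h in t, the nilpotent part of ad h in its
    Jordan decomposition is a derivation commuting with t, and K being
    nondegenerate forces it to vanish ([nilpotent_derivation_eq0],
    [cartan_ad_eigen_sum]). So g has a basis of homogeneous vectors that are
    common eigenvectors of t ([weight_basis]), the generalized roots are the
    nonzero weights w_i of this basis, and K (h, h') = sum_i w_i (h) w_i (h').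

    A root vector e = b_i and a suitable multiple f of a basis vector of the same
    degree and of opposite weight satisfy [e, f] = H_alpha, alpha = w_i. Climbing
    from a vector of weight beta with e and going down with f ([weight_string])
    gives 2 beta (H_alpha) = N alpha (H_alpha) with N an integer, and a nonzero
    vector of weight beta - N alpha ([weight_reflection]). If alpha (H_alpha)
    were 0, every weight would vanish on H_alpha, which K excludes
    ([weight_anisotropic]). This yields integrality and reflections. From
    alpha (H_alpha) = sum_l w_l (H_alpha)^2 one finds that all w_l (H_alpha) are
    real ([weight_real]).

    Finally the expression of K on t says that every functional on t is
    phi = sum_i phi (H_(w_i)) w_i ([weight_expansion]). The functionals real on
    t0 are those with real coefficients here ([t0_dualP]): they form the real
    span of the roots, real and imaginary parts of the coefficients give the real
    form, and <phi, phi> = sum_i phi (H_(w_i))^2 gives positivity. *)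

(** * Traces of operators *)

Section Trace.
Variables (F : fieldType) (V : vectType F).
Implicit Types (f h : 'End(V)).

Lemma spanning_basis (P : V -> Prop) :
    (forall x, exists2 s : seq V, {in s, forall u, P u} & x \in <<s>>%VS) ->
  exists2 b : (\dim {:V}).-tuple V, basis_of fullv b & {in b, forall u, P u}.
Proof.
move=> Pspan.
have [s sP sfull] : exists2 s : seq V, {in s, forall u, P u} & <<s>>%VS = fullv.
  suff H (l : seq V) :
      exists2 s : seq V, {in s, forall u, P u} & {subset l <= <<s>>%VS}.
    have [s sP sub] := H (vbasis {:V}).
    exists s => //; apply/eqP; rewrite eqEsubv subvf /=.
    by rewrite -(span_basis (vbasisP {:V})); apply/span_subvP.
  elim: l => [|v l [s sP sub]]; first by exists [::].
  have [s' s'P vs'] := Pspan v.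
  exists (s' ++ s) => [u|u].
    by rewrite mem_cat => /orP[/s'P|/sP].
  rewrite inE span_cat => /orP[/eqP->|/sub us].
    exact: (subvP (addvSl _ _)).
  exact: (subvP (addvSr _ _)).
have [b [bs bfree bspan]] : exists b : seq V,
    [/\ {subset b <= s}, free b & <<b>>%VS = <<s>>%VS].
  elim: s {sP sfull} => [|v s [b [bs bfree bspan]]].
    by exists [::]; rewrite nil_free.
  have [vb|vb] := boolP (v \in <<b>>%VS).
    exists b; split=> // [u /bs us|]; first by rewrite inE us orbT.
    by rewrite span_cons -bspan; apply/esym/addv_idPr; rewrite -memvE.
  exists (v :: b); split=> [u||].
  - by rewrite !inE => /orP[->//|/bs->]; rewrite orbT.
  - by rewrite free_cons vb.
  - by rewrite !span_cons bspan.
have b_basis : basis_of fullv b by rewrite /basis_of bspan sfull eqxx.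
have sz : size b == \dim {:V} by rewrite -(size_basis (X := in_tuple b) b_basis).
exists (Tuple sz) => // u /bs /sP //.
Qed.

Lemma lfun_trace_is_linear : linear (@lfun_trace F V : 'End(V) -> F^o).
Proof.
move=> a f h; rewrite /lfun_trace scaler_sumr -big_split /=.
by apply: eq_bigr => i _; rewrite add_lfunE scale_lfunE linearP.
Qed.
HB.instance Definition _ := GRing.isSemilinear.Build F 'End(V) F^o *:%R
  (@lfun_trace F V : 'End(V) -> F^o)
  (GRing.semilinear_linear lfun_trace_is_linear).

(** The trace is computed by any basis: expand each vector of one basis along
   the other one and exchange the two sums. *)
Lemma lfun_trace_basis (b : (\dim {:V}).-tuple V) f :
  basis_of fullv b -> lfun_trace f = \sum_i coord b i (f b`_i).
Proof.
move=> bb; rewrite /lfun_trace; set B := vbasis fullv.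
have -> : \sum_(i < \dim {:V}) coord B i (f B`_i) =
    \sum_(i < \dim {:V}) \sum_j coord b j (f B`_i) * coord B i b`_j.
  apply: eq_bigr => i _.
  rewrite {1}(coord_basis bb (memvf (f B`_i))) linear_sum /=.
  by apply: eq_bigr => j _; rewrite linearZ.
rewrite exchange_big; apply: eq_bigr => j _ /=.
rewrite [in RHS](coord_vbasis (memvf b`_j)) !linear_sum /=.
by apply: eq_bigr => i _; rewrite !linearZ /= mulrC.
Qed.

Lemma lfun_trace_comp f h : lfun_trace (f \o h)%VF = lfun_trace (h \o f)%VF.
Proof.
rewrite /lfun_trace; set B := vbasis fullv.
have E (u v : 'End(V)) : \sum_(i < \dim {:V}) coord B i ((u \o v)%VF B`_i) =
    \sum_(i < \dim {:V}) \sum_(j < \dim {:V})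
      coord B j (v B`_i) * coord B i (u B`_j).
  apply: eq_bigr => i _; rewrite comp_lfunE.
  rewrite {1}(coord_vbasis (memvf (v B`_i))) !linear_sum /=.
  by apply: eq_bigr => j _; rewrite !linearZ.
rewrite !E exchange_big; apply: eq_bigr => j _ /=.
by apply: eq_bigr => i _; rewrite mulrC.
Qed.

Lemma lfun_trace_mxof f :
  lfun_trace f = \tr (mxof (vbasis {:V}) (vbasis {:V}) f).
Proof.
by apply: eq_bigr => i _; rewrite !mxE /= vecof_delta.
Qed.

Definition lfun_pow f k : 'End(V) := iter k (comp_lfun f) \1%VF.

Lemma lfun_powE f k x : lfun_pow f k x = iter k f x.
Proof. by elim: k => [|k IH] /=; rewrite ?id_lfunE // comp_lfunE IH. Qed.

End Trace.

Section ClosedTrace.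
Variables (C : numClosedFieldType).

(** Every polynomial with a zero of order N at 0 has zero sum over the a_i;
    applied to one that vanishes at all the other values, this gives the
    multiplicity of a nonzero value a_j, which cannot be 0. *)
Lemma power_sums_eq0 n (a : 'I_n -> C) N :
  (forall k, \sum_i a i ^+ (N + k) = 0) -> forall i, a i = 0.
Proof.
move=> a0 j; apply/eqP/negPn/negP => aj_neq0.
have ap (p : {poly C}) : \sum_i a i ^+ N * p.[a i] = 0.
  under eq_bigr do rewrite horner_coef mulr_sumr.
  rewrite exchange_big big1 //= => k _.
  under eq_bigr do rewrite mulrCA -exprD.
  by rewrite -mulr_sumr a0 mulr0.
pose s := [seq d <- undup (codom a) | d != a j].
have := ap (\prod_(d <- s) ('X - d%:P)).
rewrite (bigID (fun i => a i == a j)) /= [X in _ + X]big1 ?addr0 => [|i aij].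
  rewrite (eq_bigr (fun=> a j ^+ N * (\prod_(d <- s) ('X - d%:P)).[a j])).
    2: by move=> i /eqP->.
  rewrite sumr_const => /eqP; rewrite -mulr_natr !mulf_eq0 expf_eq0.
  rewrite (negPf aj_neq0) andbF /= pnatr_eq0 -/(root _ _) root_prod_XsubC.
  rewrite mem_filter eqxx /= => /eqP/card0_eq a_empty.
  by have : (a j == a j) = false := a_empty j; rewrite eqxx.
rewrite (rootP _) ?mulr0 // root_prod_XsubC mem_filter aij mem_undup.
exact: codom_f.
Qed.

Lemma mul_trig_diag n (A B : 'M[C]_n) i :
  is_trig_mx A -> is_trig_mx B -> (A *m B) i i = A i i * B i i.
Proof.
move=> /is_trig_mxP At /is_trig_mxP Bt; rewrite mxE (bigD1 i) //=.
rewrite big1 ?addr0 // => k ki.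
by case: (ltngtP i k) ki => [/At->|/Bt->|/val_inj->]; rewrite ?mul0r ?mulr0 ?eqxx.
Qed.

Lemma mul_trig n (A B : 'M[C]_n) :
  is_trig_mx A -> is_trig_mx B -> is_trig_mx (A *m B).
Proof.
move=> /is_trig_mxP At /is_trig_mxP Bt; apply/is_trig_mxP => i j ij.
rewrite mxE big1 // => k _.
by case: (ltnP i k) => [/At->|ki]; rewrite ?mul0r // Bt ?mulr0 // (leq_ltn_trans ki).
Qed.

Variable V : vectType C.

(** Two commuting operators are triangular in a common basis. The diagonal of f
    has vanishing power sums, hence is zero, and so is that of f h. The shift N
    covers both the case of nilpotent f and that where all positive powers of f
    are traceless. *)
Lemma lfun_trace_comp_eq0 (f h : 'End(V)) N :
    (f \o h = h \o f)%VF -> (forall k, lfun_trace (lfun_pow f (N + k)) = 0) ->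
  lfun_trace (f \o h)%VF = 0.
Proof.
set B := vbasis {:V}; have BB : basis_of {:V} B := vbasisP _.
move=> fh f0; pose A := mxof B B f; pose Z := mxof B B h.
have AZ : A *m Z = Z *m A by rewrite -!(mxof_comp _ _ BB) // fh.
have [P Pu /andP[/= At Zt]] := cotrigonalization2 AZ.
have {}Pu := unitarymx_unit Pu.
pose T (M : 'M_(\dim {:V})) := conjmx P M.
have TM M M' : T (M *m M') = T M *m T M'.
  by rewrite /T !conjumx // !mulmxA mulmxKV.
have trT M : \tr (T M) = \tr M.
  by rewrite /T conjumx // -mulmxA mxtrace_mulC mulmxKV.
have powT k : is_trig_mx (T (mxof B B (lfun_pow f k))) /\
    forall i, T (mxof B B (lfun_pow f k)) i i = T A i i ^+ k.
  elim: k => [|k [IHt IHd]].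
    rewrite /= mxof1 ?(basis_free BB) // /T conjumx // mulmx1 mulmxV //.
    by split=> [|i]; rewrite ?scalar_mx_is_trig // mxE eqxx expr0.
  rewrite /= (mxof_comp _ _ BB) // TM; split=> [|i]; first exact: mul_trig.
  by rewrite mul_trig_diag // IHd exprSr.
have d0 : forall i, T A i i = 0.
  apply: (@power_sums_eq0 _ _ N) => k.
  rewrite -[RHS](f0 k) lfun_trace_mxof -trT.
  by apply: eq_bigr => i _; rewrite (powT _).2.
rewrite lfun_trace_comp lfun_trace_mxof (mxof_comp _ _ BB) // -trT TM.
by apply: big1 => i _; rewrite mul_trig_diag // d0 mul0r.
Qed.
End ClosedTrace.

(** * Polynomials in an operator and generalized eigenvectors *)

Section FunctionalCalculus.
Variables (F : fieldType) (V : vectType F).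
Implicit Types (f h : 'End(V)) (p q : {poly F}).

Definition lfun_horner f p : 'End(V) := \sum_(i < size p) p`_i *: lfun_pow f i.

Lemma lfun_horner_wide f p n : (size p <= n)%N ->
  lfun_horner f p = \sum_(i < n) p`_i *: lfun_pow f i.
Proof.
move=> pn; rewrite /lfun_horner (big_ord_widen n (fun i => p`_i *: lfun_pow f i)) //.
rewrite big_mkcond; apply: eq_bigr => i _.
by case: ltnP => // /(nth_default 0)->; rewrite scale0r.
Qed.

Lemma lfun_horner_is_linear f : linear (lfun_horner f).
Proof.
move=> a p q; pose n := maxn (size p) (size q).
rewrite !(@lfun_horner_wide f _ n) ?leq_maxl ?leq_maxr //.
  rewrite scaler_sumr -big_split; apply: eq_bigr => i _ /=.
  by rewrite coefD coefZ scalerDl scalerA.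
rewrite (leq_trans (size_polyD _ _)) // geq_max leq_maxr andbT.
by rewrite (leq_trans (size_scale_leq _ _)) // leq_maxl.
Qed.
HB.instance Definition _ f := GRing.isSemilinear.Build F {poly F} 'End(V) *:%R
  (lfun_horner f) (GRing.semilinear_linear (lfun_horner_is_linear f)).

Lemma lfun_hornerC f c x : lfun_horner f c%:P x = c *: x.
Proof.
rewrite (@lfun_horner_wide f _ 1) ?size_polyC ?leq_b1 // big_ord1 coefC eqxx.
by rewrite scale_lfunE id_lfunE.
Qed.

Lemma lfun_horner1 f x : lfun_horner f 1 x = x.
Proof. by rewrite lfun_hornerC scale1r. Qed.

Lemma lfun_hornerMX f p x : lfun_horner f (p * 'X) x = lfun_horner f p (f x).
Proof.
rewrite (@lfun_horner_wide f _ (size p).+1).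
  rewrite big_ord_recl coefMX eqxx scale0r add0r !sum_lfunE.
  by apply: eq_bigr => i _; rewrite coefMX !scale_lfunE !lfun_powE iterSr.
by rewrite (leq_trans (size_polyMleq _ _)) // size_polyX addnC.
Qed.

Lemma lfun_hornerX f x : lfun_horner f 'X x = f x.
Proof. by rewrite -['X]mul1r lfun_hornerMX lfun_horner1. Qed.

Lemma lfun_hornerDE f p q x :
  lfun_horner f (p + q) x = lfun_horner f p x + lfun_horner f q x.
Proof. by rewrite linearD add_lfunE. Qed.

Lemma lfun_hornerBE f p q x :
  lfun_horner f (p - q) x = lfun_horner f p x - lfun_horner f q x.
Proof. by rewrite linearB add_lfunE opp_lfunE. Qed.

Lemma lfun_horner_stable f (U : {vspace V}) p x :
  (forall y, y \in U -> f y \in U) -> x \in U -> lfun_horner f p x \in U.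
Proof.
move=> fU xU; elim/poly_ind: p x xU => [|p c IH] x xU.
  by rewrite linear0 zero_lfunE mem0v.
rewrite lfun_hornerDE lfun_hornerMX lfun_hornerC.
by rewrite memvD ?memvZ ?IH ?fU.
Qed.

Lemma lfun_horner_comm f h p :
    (forall x, f (h x) = h (f x)) ->
  forall x, lfun_horner f p (h x) = h (lfun_horner f p x).
Proof.
move=> fh; elim/poly_ind: p => [|p c IH] x.
  by rewrite linear0 !zero_lfunE linear0.
by rewrite !lfun_hornerDE !lfun_hornerMX !lfun_hornerC fh IH linearD linearZ.
Qed.

Lemma lfun_hornerM f p q x :
  lfun_horner f (p * q) x = lfun_horner f p (lfun_horner f q x).
Proof.
elim/poly_ind: p x => [|p c IH] x; first by rewrite mul0r !linear0 !zero_lfunE.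
rewrite mulrDl -mulrA ['X * q]mulrC mulrA !lfun_hornerDE !lfun_hornerMX IH.
rewrite mul_polyC linearZ scale_lfunE lfun_hornerC; congr (lfun_horner f p _ + _).
exact: lfun_horner_comm.
Qed.

Lemma lfun_hornerXn f p k x :
  lfun_horner f (p ^+ k) x = iter k (lfun_horner f p) x.
Proof.
by elim: k x => [|k IH] x; rewrite ?lfun_horner1 // exprS lfun_hornerM IH.
Qed.

Lemma lfun_horner_XsubC f c x : lfun_horner f ('X - c%:P) x = f x - c *: x.
Proof. by rewrite lfun_hornerBE lfun_hornerX lfun_hornerC. Qed.

Lemma lfun_horner_gen f c k x :
  lfun_horner f (('X - c%:P) ^+ k) x = iter k (fun y => f y - c *: y) x.
Proof. by rewrite lfun_hornerXn; apply: eq_iter => y; rewrite lfun_horner_XsubC. Qed.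

Lemma lfun_horner_dvd f p q x :
  p %| q -> lfun_horner f p x = 0 -> lfun_horner f q x = 0.
Proof. by move=> /dvdpP[r ->] px; rewrite lfun_hornerM px linear0. Qed.

(** The powers of f live in a finite dimensional space, so that they satisfy a
   nontrivial linear relation. *)
Lemma lfun_annihilator f :
  exists2 p : {poly F}, p != 0 & forall x, lfun_horner f p x = 0.
Proof.
pose n := (\dim {: 'End(V)}).+1.
pose X := [tuple lfun_pow f i | i < n].
have nfree : ~ free X.
  by move=> /eqP sX; have := dimvS (subvf <<X>>%VS); rewrite sX size_tuple ltnn.
have : ~ forall k, \sum_(i < n) k i *: X`_i = 0 -> forall i, k i = 0.
  by move/freeP.
move=> /boolp.existsNP[k] /boolp.not_implyP[k0 /boolp.existsNP[i /eqP ki]].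
exists (\poly_(j < n) k (inord j)) => [|x].
  apply: contraNneq ki => /polyP/(_ i).
  by rewrite coef_poly ltn_ord inord_val coef0 => ->.
suff -> : lfun_horner f (\poly_(j < n) k (inord j)) = 0 by rewrite zero_lfunE.
rewrite (lfun_horner_wide _ (size_poly _ _)) -[RHS]k0; 
 apply: eq_bigr => j _.
by rewrite coef_poly ltn_ord inord_val -tnth_nth tnth_mktuple.
Qed.

End FunctionalCalculus.

Section Jordan.
Variable F : fieldType.

Lemma coprime_XsubC_exp_prod (s : seq F) d N : d \notin s ->
  coprimep (\prod_(c <- s) ('X - c%:P) ^+ N) (('X - d%:P) ^+ N).
Proof.
move=> ds; apply: coprimep_expr; rewrite coprimep_XsubC rootE horner_prod.
rewrite prodf_seq_neq0; apply/allP => c cs; rewrite horner_exp !hornerE expf_neq0 //.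
by rewrite subr_eq0; apply: contraNneq ds => ->.
Qed.

Lemma poly_chinese (s : seq F) N (v : F -> {poly F}) : uniq s ->
  exists q, {in s, forall c, ('X - c%:P) ^+ N %| q - v c}.
Proof.
elim: s => [|d s IH] /=; first by exists 0.
move=> /andP[ds /IH[q qP]]; set R := \prod_(c <- s) ('X - c%:P) ^+ N.
have /Bezout_eq1_coprimepP[[u w] /= uw] := coprime_XsubC_exp_prod N ds.
rewrite -/R in uw.
(* u R is 1 modulo the new factor and 0 modulo the old ones *)
exists (q + u * R * (v d - q)) => c; rewrite inE => /orP[/eqP->|cs].
  have -> : q + u * R * (v d - q) - v d = (q - v d) * (1 - u * R) by ring.
  by rewrite -uw addrAC subrr add0r mulrA dvdp_mull.
have -> : q + u * R * (v d - q) - v c = (q - v c) + u * (v d - q) * R by ring.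
rewrite dvdp_add ?qP // dvdp_mull // /R (big_rem c) //= dvdp_mulIl //.
Qed.

Variable V : vectType F.
Implicit Type f : 'End(V).

(** The components are obtained by applying polynomials in f, so they stay in
   every f-stable subspace containing x. *)
Lemma generalized_eigen_sum f (s : seq F) N (U : {vspace V}) x : uniq s ->
    (forall y, y \in U -> f y \in U) -> x \in U ->
    lfun_horner f (\prod_(c <- s) ('X - c%:P) ^+ N) x = 0 ->
  exists u : F -> V, [/\ x = \sum_(c <- s) u c, forall c, u c \in U &
    {in s, forall c, lfun_horner f (('X - c%:P) ^+ N) (u c) = 0}].
Proof.
move=> us fU; elim: s us x => [_ x xU|d s IH /= /andP[ds us] x xU].
  rewrite big_nil lfun_horner1 => x0.
  by exists (fun=> 0); split=> // [|c]; rewrite ?big_nil ?mem0v.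
rewrite big_cons => x0; set R := \prod_(c <- s) ('X - c%:P) ^+ N in x0 *.
have /Bezout_eq1_coprimepP[[p q] /= pq] := coprime_XsubC_exp_prod N ds.
rewrite -/R in pq; set Q := ('X - d%:P) ^+ N in pq x0 *.
have [||u [xu uU uP]] := IH us (lfun_horner f (q * Q) x).
- exact: lfun_horner_stable.
- rewrite -lfun_hornerM.
  have -> : R * (q * Q) = q * (Q * R) by ring.
  by rewrite lfun_hornerM x0 linear0.
exists (fun c => if c == d then lfun_horner f (p * R) x else u c); split.
- rewrite big_cons eqxx -[LHS](lfun_horner1 f) -pq lfun_hornerDE xu.
  congr (_ + _); apply: eq_big_seq => c cs.
  by case: eqP => // cd; rewrite -cd cs in ds.
- by move=> c; case: eqP => // _; apply: lfun_horner_stable.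
- move=> c; rewrite inE => /orP[/eqP->|cs].
    rewrite eqxx -lfun_hornerM; apply: lfun_horner_dvd x0.
    by rewrite mulrCA dvdp_mull.
  by case: eqP => [cd|_]; [rewrite -cd cs in ds | apply: uP].
Qed.
End Jordan.

Lemma split_annihilator (C : closedFieldType) (V : vectType C) (f : 'End(V)) :
  exists s : seq C, exists2 N, uniq s & (0 < N)%N /\
    forall x, lfun_horner f (\prod_(c <- s) ('X - c%:P) ^+ N) x = 0.
Proof.
have [p p0 pf] := lfun_annihilator f.
have [r pE] := closed_field_poly_normal p.
exists (undup r), (size r).+1; rewrite ?undup_uniq //; split=> // x.
apply: lfun_horner_dvd (pf x); rewrite pE dvdpZl ?lead_coef_eq0 //.
rewrite -big_undup_iterop_count; elim/big_rec2: _ => // c p1 p2 _ p12.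
by rewrite dvdp_mul //; apply: (@dvdp_exp2l _ ('X - c%:P)); apply/leqW/count_size.
Qed.

(** * Brackets, degrees and the Killing form *)

Lemma Z2Z2_addxx (a : Z2Z2) : a + a = 0.
Proof. by case: a => [[[|[|?]] //= ?] [[|[|?]] //= ?]]; apply/eqP. Qed.

Lemma Z2Z2_add_neq0 (a b : Z2Z2) : a != b -> a + b != 0.
Proof.
apply: contra_neq => ab0.
by rewrite -[a]addr0 -(Z2Z2_addxx b) addrA ab0 add0r.
Qed.

Lemma sgn_form0 (a : Z2Z2) : sgn_form 0 a = 0.
Proof. by rewrite /sgn_form !mul0r subrr. Qed.

Lemma sgn_formxx (a : Z2Z2) : sgn_form a a = 0.
Proof. by rewrite /sgn_form mulrC subrr. Qed.

Section GradedLie.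
Variables (K : fieldType) (g : vectType K) (L : gradedLie g).
Local Notation "[[ x , y ]]" := (bracket L x y).
Local Notation g0 := (homog L 0).
Local Notation ad := (ad L).
Local Notation killing := (killing L).

Lemma adE x y : ad x y = [[x, y]]. Proof. by rewrite lfunE. Qed.

Lemma homog_decomp x :
  exists2 u : Z2Z2 -> g, forall a, u a \in homog L a & x = \sum_a u a.
Proof.
have : x \in (\sum_a homog L a)%VS by rewrite homog_sum memvf.
by case/memv_sumP => u uP ->; exists u => // a; apply: uP.
Qed.

Lemma homog_lfunP (f h : 'End(g)) :
  (forall a, {in homog L a, f =1 h}) -> f = h.
Proof.
move=> fh; apply/lfunP => x; have [u uP ->] := homog_decomp x.
by rewrite !linear_sum; apply: eq_bigr => a _; apply: fh.
Qed.

(** The commutation sign is trivial as soon as one argument has degree 0. *)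
Lemma jacobi0 h x y : h \in g0 ->
  [[h, [[x, y]]]] = [[ [[h, x]], y]] + [[x, [[h, y]]]].
Proof.
move=> h0; have [u uP ->] := homog_decomp x.
rewrite !(linear_sumlz, linear_sumr) -big_split; apply: eq_bigr => a _ /=.
by rewrite (bracket_jacobi _ h0 (uP a)) sgn_form0 expr0 scale1r.
Qed.

Lemma bracket_anti0 h x : h \in g0 -> [[x, h]] = - [[h, x]].
Proof.
move=> h0; have [u uP ->] := homog_decomp x.
rewrite !(linear_sumlz, linear_sumr) -sumrN; apply: eq_bigr => a _ /=.
by rewrite [in RHS](bracket_sym h0 (uP a)) sgn_form0 expr0 scale1r opprK.
Qed.

Lemma ad_bracket0 h x : h \in g0 ->
  ad [[h, x]] = ((ad h \o ad x) - (ad x \o ad h))%VF.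
Proof.
move=> h0; apply/lfunP => y.
by rewrite add_lfunE opp_lfunE !comp_lfunE !adE jacobi0 // addrK.
Qed.

(** Two elements of the same degree bracket as in an ordinary Lie algebra. *)
Lemma ad_bracket_same a x y : x \in homog L a -> y \in homog L a ->
  ad [[x, y]] = ((ad x \o ad y) - (ad y \o ad x))%VF.
Proof.
move=> xa ya; apply/lfunP => z.
rewrite add_lfunE opp_lfunE !comp_lfunE !adE (bracket_jacobi _ xa ya).
by rewrite sgn_formxx expr0 scale1r addrK.
Qed.

Lemma bracket_homog0 a h x : h \in g0 -> x \in homog L a -> [[h, x]] \in homog L a.
Proof. by move=> h0 xa; rewrite -[a]add0r bracket_homog. Qed.

Lemma bracket_same_homog0 a x y :
  x \in homog L a -> y \in homog L a -> [[x, y]] \in g0.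
Proof. by move=> xa ya; rewrite -(Z2Z2_addxx a) bracket_homog. Qed.

Lemma ad_is_linear : linear ad.
Proof.
move=> c x y; apply/lfunP => z.
by rewrite add_lfunE scale_lfunE !adE linearDl linearZl_LR.
Qed.
HB.instance Definition _ := GRing.isSemilinear.Build K g 'End(g) *:%R ad
  (GRing.semilinear_linear ad_is_linear).

Definition ad_trace (f : 'End(g)) x : K^o := lfun_trace (ad x \o f)%VF.

Lemma ad_trace_is_linear f : linear (ad_trace f).
Proof.
by move=> c x y; rewrite /ad_trace linearP comp_lfunDl -comp_lfunZl linearP.
Qed.
HB.instance Definition _ f := GRing.isSemilinear.Build K g K^o *:%R
  (ad_trace f) (GRing.semilinear_linear (ad_trace_is_linear f)).

(** ad [h, x] is a commutator, so it is orthogonal to the commutant of ad h. *)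
Lemma ad_trace_bracket f h x : h \in g0 ->
  (ad h \o f = f \o ad h)%VF -> ad_trace f [[h, x]] = 0.
Proof.
move=> h0 hf; rewrite /ad_trace ad_bracket0 // comp_lfunDl comp_lfunNl.
rewrite linearB /= -comp_lfunA [in X in X - _]lfun_trace_comp -!comp_lfunA hf.
by rewrite subrr.
Qed.

Lemma killing_is_bilinear :
  bilinear_for *:%R *:%R (killing : g -> g -> K^o).
Proof.
split=> [y|x] c u v; rewrite /killing /= linearP.
  by rewrite comp_lfunDl -comp_lfunZl linearP.
by rewrite comp_lfunDr -comp_lfunZr linearP.
Qed.
HB.instance Definition _ := bilinear_isBilinear.Build K g g K^o *:%R *:%R
  (killing : g -> g -> K^o) killing_is_bilinear.

Lemma killing_is_linear x : linear (killing x : g -> K^o).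
Proof. by move=> c u v; apply: linearPr. Qed.
HB.instance Definition _ x := GRing.isSemilinear.Build K g K^o *:%R
  (killing x : g -> K^o) (GRing.semilinear_linear (killing_is_linear x)).

Lemma killingC x y : killing x y = killing y x.
Proof. exact: lfun_trace_comp. Qed.

Lemma killing0l x : killing 0 x = 0. Proof. exact: linear0l. Qed.
Lemma killingDl x y z : killing (x + y) z = killing x z + killing y z.
Proof. exact: linearDl. Qed.
Lemma killingBl x y z : killing (x - y) z = killing x z - killing y z.
Proof. exact: linearBl. Qed.
Lemma killingZl c x y : killing (c *: x) y = c * killing x y.
Proof. exact: linearZl_LR. Qed.
Lemma killingZr c x y : killing x (c *: y) = c * killing x y.
Proof. exact: linearZr_LR. Qed.
Lemma killing_sumr I r (P : pred I) x (E : I -> g) :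
  killing x (\sum_(i <- r | P i) E i) = \sum_(i <- r | P i) killing x (E i).
Proof. exact: linear_sumr. Qed.

Lemma lfun_traceB (f h : 'End(g)) : lfun_trace (f - h) = lfun_trace f - lfun_trace h.
Proof. exact: linearB. Qed.

Lemma killing_invariant h x y : h \in g0 ->
  killing [[h, x]] y = - killing x [[h, y]].
Proof.
move=> h0; rewrite /killing !ad_bracket0 // comp_lfunDl comp_lfunDr comp_lfunNl.
rewrite comp_lfunNr !lfun_traceB !comp_lfunA opprB.
by congr (_ - _); rewrite -[in LHS]comp_lfunA lfun_trace_comp.
Qed.

Lemma killing_bracket_same a e f h :
    e \in homog L a -> f \in homog L a -> h \in g0 ->
  killing [[e, f]] h = killing [[h, e]] f.
Proof.
move=> ea fa h0; rewrite /killing (ad_bracket_same ea fa) ad_bracket0 //.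
rewrite !comp_lfunDl !comp_lfunNl !lfun_traceB.
rewrite [in X in X - _ = _]lfun_trace_comp comp_lfunA; congr (_ - _).
by rewrite -comp_lfunA lfun_trace_comp.
Qed.

(** Composing with the projections of the grading, an operator of nonzero
   degree is a sum of operators P F P = 0 up to commutators. *)
Lemma lfun_trace_shift c (f : 'End(g)) : c != 0 ->
  (forall a x, x \in homog L a -> f x \in homog L (a + c)) -> lfun_trace f = 0.
Proof.
move=> c0 fc; pose P a := sumv_pi_for (esym (homog_sum L)) a.
have PE x : \sum_a P a x = x by apply: sumv_pi_sum; apply: memvf.
have Pin a x : P a x \in homog L a by apply: memv_sum_pi.
have PP a b x : x \in homog L b -> P a x = if a == b then x else 0.
  move=> xb.
  have uniq := elimT directv_sum_unique (homog_direct L).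
  have := uniq (P ^~ x) (fun d => if d == b then x else 0).
  rewrite PE -big_mkcond /= big_pred1_eq eqxx => {}uniq.
  have all_eq := uniq (fun d _ => Pin d x) _; apply/eqP.
  apply: (forallP (esym (all_eq _)) a) => d _.
  by case: eqP => [->|]; rewrite ?mem0v.
have -> : f = \sum_a (f \o P a)%VF.
  apply/lfunP => x; rewrite sum_lfunE -{1}(PE x) linear_sum.
  by apply: eq_bigr => a _; rewrite comp_lfunE.
rewrite linear_sum big1 //= => a _.
have -> : (f \o P a = f \o P a \o P a)%VF.
  by apply/lfunP => x; rewrite !comp_lfunE (PP a a (P a x)) ?eqxx.
rewrite lfun_trace_comp (_ : (_ \o _)%VF = 0) ?linear0 //.
apply/lfunP => x; rewrite !comp_lfunE zero_lfunE (PP a (a + c) (f (P a x))) ?fc //.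
by rewrite -{1}[a]addr0 (inj_eq (addrI a)) eq_sym (negPf c0).
Qed.

Lemma killing_homog_orth a b x y : a != b ->
  x \in homog L a -> y \in homog L b -> killing x y = 0.
Proof.
move=> ab xa yb; apply: (@lfun_trace_shift (a + b)); first exact: Z2Z2_add_neq0.
move=> c z zc; rewrite comp_lfunE !adE addrC -addrA.
by apply: bracket_homog => //; apply: bracket_homog.
Qed.

(** Leibniz rule for the generalized eigenvectors of ad h. *)
Lemma iter_ad_bracket h c d x y m n : h \in g0 ->
    iter m (fun z => ad h z - c *: z) x = 0 ->
    iter n (fun z => ad h z - d *: z) y = 0 ->
  iter (m + n) (fun z => ad h z - (c + d) *: z) [[x, y]] = 0.
Proof.
move=> h0; have iter0 k e : iter k (fun z => ad h z - e *: z) 0 = 0.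
  by elim: k => //= k ->; rewrite linear0 scaler0 subr0.
have iterD k e u v : iter k (fun z => ad h z - e *: z) (u + v) =
    iter k (fun z => ad h z - e *: z) u + iter k (fun z => ad h z - e *: z) v.
  by elim: k => //= k ->; rewrite linearD scalerDr opprD addrACA.
elim: {m n}(m + n)%N {-2}m {-2}n (erefl (m + n)%N) x y => [|k IH] m n mn x y.
  by move/eqP: mn; rewrite addn_eq0 => /andP[/eqP-> _] /= ->; rewrite linear0l.
case: m mn => [_|m mn xm]; first by move=> x0; rewrite [x]x0 linear0l iter0.
case: n mn => [_ y0|n mn yn]; first by rewrite [y]y0 linear0r iter0.
rewrite addSn iterSr adE jacobi0 //.
have -> : [[ [[h, x]], y]] + [[x, [[h, y]]]] - (c + d) *: [[x, y]] =
    [[ad h x - c *: x, y]] + [[x, ad h y - d *: y]].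
  rewrite !adE linearBl linearBr linearZl_LR linearZr_LR /= scalerDl opprD.
  by rewrite addrACA.
move: mn; rewrite addSn => -[mn].
rewrite iterD (IH m n.+1) //; last by rewrite -iterSr.
rewrite add0r addnS -addSn; apply: IH => //; last by rewrite -iterSr.
by rewrite -mn addnS.
Qed.

End GradedLie.

(** * Cartan subalgebras: Engel and Fitting arguments *)

Section Fitting.
Variables (F : fieldType) (V : vectType F).

(** The annihilating polynomial of f is X^m q with q prime to X, and a Bezout
   relation between X^m and q splits the space. *)
Lemma fitting (f : 'End(V)) n : exists m,
  [/\ (n <= m)%N, forall k x, iter k f x = 0 -> iter m f x = 0 &
    forall (U : {vspace V}) x, (forall y, y \in U -> f y \in U) -> x \in U ->
      exists y z, [/\ y \in U, z \in U, x = y + iter m f z & iter m f y = 0]].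
Proof.
have [p p0 pf] := lfun_annihilator f.
have [a [q]] := multiplicity_XsubC p 0; rewrite p0 subr0 /= => q0 pE.
have hX k x : lfun_horner f ('X ^+ k) x = iter k f x.
  by rewrite lfun_hornerXn; apply: eq_iter => y; rewrite lfun_hornerX.
pose m := maxn n a; have qX x : lfun_horner f (q * 'X^m) x = 0.
  by apply: lfun_horner_dvd (pf x); rewrite pE dvdp_mul // dvdp_exp2l // leq_maxr.
have cop k : coprimep 'X^k q.
  apply: coprimep_expl; rewrite coprimep_sym -[X in coprimep _ X]subr0.
  by rewrite coprimep_XsubC.
exists m; split=> [|k x xk|U x fU xU]; first exact: leq_maxl.
  have /Bezout_eq1_coprimepP[[u v] /= uv] := cop k.
  rewrite -hX -[x](lfun_horner1 f) -uv lfun_hornerDE linearD /= -!lfun_hornerM.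
  have -> : 'X^m * (u * 'X^k) = 'X^m * u * 'X^k by rewrite mulrA.
  have -> : 'X^m * (v * q) = v * (q * 'X^m) by rewrite mulrCA ['X^m * q]mulrC.
  by rewrite lfun_hornerM hX xk linear0 lfun_hornerM qX linear0 addr0.
have /Bezout_eq1_coprimepP[[u v] /= uv] := cop m.
exists (lfun_horner f (v * q) x), (lfun_horner f u x).
split; rewrite ?lfun_horner_stable // -hX -lfun_hornerM.
  by rewrite -[LHS](lfun_horner1 f) -uv addrC lfun_hornerDE [u * _]mulrC.
have -> : 'X^m * (v * q) = v * (q * 'X^m) by rewrite mulrCA ['X^m * q]mulrC.
by rewrite lfun_hornerM qX linear0.
Qed.
End Fitting.

Section Cartan.
Variables (F : fieldType) (g : vectType F) (L : gradedLie g) (t : {vspace g}).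
Local Notation "[[ x , y ]]" := (bracket L x y).
Local Notation g0 := (homog L 0).
Local Notation ad := (ad L).
Local Notation killing := (killing L).
Implicit Types (U W M : {vspace g}) (x y z h : g).

Lemma mem_bracketv U W x y : x \in U -> y \in W -> [[x, y]] \in bracketv L U W.
Proof.
move=> /coord_vbasis-> /coord_vbasis->; rewrite linear_sumlz rpred_sum // => i _.
rewrite linear_sumr rpred_sum // => j _.
rewrite linearZl_LR linearZr_LR /= !memvZ // memv_span //.
apply/allpairsP; exists ((vbasis U)`_i, (vbasis W)`_j).
by rewrite !mem_nth ?size_tuple.
Qed.

Lemma bracketv_sub U W M :
  (forall x y, x \in U -> y \in W -> [[x, y]] \in M) -> (bracketv L U W <= M)%VS.
Proof.
move=> UWM; apply/span_subvP => z /allpairsP[ [x y] [/= xU yW ->] ].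
by rewrite UWM // vbasis_mem.
Qed.

Hypothesis t_cartan : cartan_subalgebra L t.

Local Notation lcs k := (iter k (bracketv L t) t).

Lemma cartan_sub0 x : x \in t -> x \in g0.
Proof. by case: t_cartan => /subvP tg _ _ _ /tg. Qed.

Lemma cartan_bracket x y : x \in t -> y \in t -> [[x, y]] \in t.
Proof. by case: t_cartan => _ tt _ _; apply: tt. Qed.

Lemma cartan_normalizer x : x \in g0 ->
  (forall h, h \in t -> [[h, x]] \in t) -> x \in t.
Proof.
case: t_cartan => _ _ _ normt x0 xt; apply: normt => // h ht.
by rewrite bracket_anti0 ?memvN ?xt // cartan_sub0.
Qed.

Lemma lcs_sub k : (lcs k <= t)%VS.
Proof.
elim: k => //= k IH; apply: bracketv_sub => x y xt /(subvP IH) yt.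
exact: cartan_bracket.
Qed.

Lemma cartan_ad_nilpotent :
  exists n, forall h x, h \in t -> x \in t -> iter n (ad h) x = 0.
Proof.
case: t_cartan => _ _ [n tn] _; exists n => h x ht xt.
apply/eqP; rewrite -memv0 -tn; elim: n {tn} => //= n IH.
by rewrite adE mem_bracketv.
Qed.

(** Engel's argument: an ideal s of t that annihilates some vector of U / t is
   enlarged by an element h that t maps into s; the space annihilated by s is
   stable under h, which is nilpotent. *)
Lemma engel_cartan U : (t <= U)%VS -> (U <= g0)%VS ->
    (forall h x, h \in t -> x \in U -> [[h, x]] \in U) ->
    (forall h x, h \in t -> x \in U -> exists k, iter k (ad h) x \in t) ->
  U = t.
Proof.
move=> tU Ug tUU nilU; apply/eqP; rewrite eqEsubv tU andbT.
apply/negPn/negP => /subvPn[x0 x0U x0t].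
suff [x [xU /negP xt tx] ] : exists x, [/\ x \in U, x \notin t &
    forall y, y \in t -> [[y, x]] \in t].
  by apply: xt; apply: cartan_normalizer => //; apply: (subvP Ug).
suff grow d s : (\dim t - \dim s <= d)%N -> (s <= t)%VS ->
    (forall h y, h \in t -> y \in s -> [[h, y]] \in s) ->
    (exists x, [/\ x \in U, x \notin t & forall y, y \in s -> [[y, x]] \in t]) ->
  exists x, [/\ x \in U, x \notin t & forall y, y \in t -> [[y, x]] \in t].
  apply: (grow (\dim t) 0%VS); rewrite ?leq_subr ?sub0v //.
    by move=> h y _; rewrite !memv0 => /eqP->; rewrite linear0r.
  by exists x0; split=> // y; rewrite memv0 => /eqP->; rewrite linear0l mem0v.
elim: d s => [|d IH] s ds st ts [x [xU xt sx] ].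
  exists x; split=> // y yt; apply: sx.
  suff /eqP-> : s == t by [].
  by rewrite eqEdim st -subn_eq0 -leqn0.
have [tsub|ntsub] := boolP (t <= s)%VS.
  by exists x; split=> // y /(subvP tsub); apply: sx.
have [n tn] : nilpotentv L t by case: t_cartan.
have ex_lcs : exists k, (lcs k <= s)%VS by exists n; rewrite tn sub0v.
case: (ex_minnP ex_lcs) => -[|k] lcsk kmin; first by rewrite lcsk in ntsub.
have /subvPn[h hk hs] : ~~ (lcs k <= s)%VS.
  by apply/negP => /kmin; rewrite ltnn.
have ht := subvP (lcs_sub k) _ hk.
have th y : y \in t -> [[y, h]] \in s.
  by move=> yt; apply: (subvP lcsk); apply: mem_bracketv.
apply: (IH (s + <[h]>)%VS).
- rewrite leq_subLR (leq_trans _ (_ : (\dim s).+1 + d <= _)%N) //.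
    by rewrite addSn -addnS -leq_subLR.
  rewrite leq_add2r ltn_neqAle dimvS ?addvSl // andbT.
  apply: contraNneq hs => /eqP; rewrite (dimv_leqif_eq (addvSl _ _)) => /eqP->.
  by rewrite memvE addvSr.
- by rewrite subv_add st.
- move=> y z yt /memv_addP[z1 z1s [z2 /vlineP[c ->] ->] ].
  rewrite linearDr linearZr_LR /= memvD ?memvZ //.
    by rewrite (subvP (addvSl _ _)) ?ts.
  by rewrite (subvP (addvSl _ _)) ?th.
have iterP j : iter j (ad h) x \in U /\
    forall y, y \in s -> [[y, iter j (ad h) x]] \in t.
  elim: j => [|j [jU js] ] //=; rewrite adE; split=> [|y ys]; first exact: tUU.
  have yt := subvP st _ ys.
  rewrite jacobi0 ?(cartan_sub0 yt) // memvD //; last first.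
    exact: cartan_bracket ht (js y ys).
  apply: js; have := ts h y ht ys.
  by rewrite (bracket_anti0 _ (cartan_sub0 ht)) memvN.
case: (ex_minnP (nilU h x ht xU)) => -[|j] jt jmin; first by rewrite jt in xt.
exists (iter j (ad h) x); split; first by have [] := iterP j.
  by apply/negP => /jmin; rewrite ltnn.
move=> y /memv_addP[z1 z1s [z2 /vlineP[c ->] ->] ].
rewrite linearDl linearZl_LR /=; apply: memvD; first exact: (iterP j).2.
by apply: memvZ; rewrite -adE.
Qed.

(** A subspace containing t and the Fitting one-components of all ad h, h in t,
   contains g0: replacing U by its intersection with the null component of
   some ad h preserves U + M = g0 until U = t by Engel's argument. *)
Lemma cartan_complement n M : (t <= M)%VS ->
    (forall h x, h \in t -> x \in t -> iter n (ad h) x = 0) ->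
    (forall h y k, h \in t -> y \in g0 -> (n <= k)%N -> iter k (ad h) y \in M) ->
  (g0 <= M)%VS.
Proof.
move=> tM tnil hM.
suff shrink d U : (\dim U <= d)%N -> (t <= U)%VS -> (U <= g0)%VS ->
    (forall h x, h \in t -> x \in U -> [[h, x]] \in U) -> (g0 <= U + M)%VS ->
    (g0 <= M)%VS.
  apply: (shrink (\dim g0) g0); rewrite ?subvv ?addvSl //.
    by case: t_cartan.
  by move=> h x /cartan_sub0 h0; apply: bracket_homog0.
elim: d U => [|d IH] U dU tU Ug tUU UM.
  move: dU; rewrite leqn0 dimv_eq0 => /eqP U0.
  by rewrite U0 add0v in UM.
have [nilU|] := pselect (forall h x, h \in t -> x \in U ->
    exists k, iter k (ad h) x \in t).
  by move: UM; rewrite (engel_cartan tU Ug tUU nilU) (addv_idPr tM).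
move=> /existsNP[h] /existsNP[x] /not_implyP[ht] /not_implyP[xU] xnil.
have [m [nm iterm split_m] ] := fitting (ad h) n.
have Uh y : y \in U -> ad h y \in U by rewrite adE; apply: tUU.
apply: (IH (U :&: lker (lfun_pow (ad h) m))%VS).
- rewrite -ltnS (leq_trans _ dU) // ltn_neqAle dimvS ?capvSl // andbT.
  apply/negP; rewrite (dimv_leqif_sup (capvSl _ _)) => /subvP/(_ x xU).
  rewrite memv_cap memv_ker lfun_powE => /andP[_ /eqP xm].
  by apply: xnil; exists m; rewrite xm mem0v.
- rewrite subv_cap tU; apply/subvP => y yt; rewrite memv_ker lfun_powE.
  by rewrite (iterm n) // tnil.
- by rewrite (subv_trans (capvSl _ _)).
- move=> y z yt; rewrite !memv_cap !memv_ker !lfun_powE => /andP[zU /eqP zm].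
  rewrite tUU //=; apply/eqP; apply: (iterm (n + m)%N).
  have iter0 k w : iter k (fun v => ad h v - 0 *: v) w = iter k (ad h) w.
    by apply: eq_iter => v; rewrite scale0r subr0.
  have := @iter_ad_bracket _ _ L h 0 0 y z n m (cartan_sub0 ht).
  by rewrite addr0 !iter0 tnil //; apply.
- apply/subvP => y /(subvP UM)/memv_addP[u uU [w wM ->] ].
  have [u1 [u2 [u1U u2U -> u1m] ] ] := split_m U u Uh uU.
  rewrite -addrA memv_add ?memvD ?hM ?(subvP Ug _ u2U) //.
  by rewrite memv_cap u1U memv_ker lfun_powE u1m eqxx.
Qed.

Lemma killing_iter_ad k h x y : h \in g0 ->
  killing x (iter k (ad h) y) = (-1) ^+ k * killing (iter k (ad h) x) y.
Proof.
move=> h0; elim: k x y => [|k IH] x y; first by rewrite mul1r.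
rewrite iterSr IH adE iterS adE killing_invariant //.
by rewrite exprS mulN1r mulrN mulNr opprK.
Qed.

Hypothesis K_nondeg : forall x, (forall y, killing x y = 0) -> x = 0.

Lemma killing_nondeg_homog a x : x \in homog L a ->
  (forall y, y \in homog L a -> killing x y = 0) -> x = 0.
Proof.
move=> xa x0; apply: K_nondeg => y; have [u uP ->] := homog_decomp L y.
rewrite killing_sumr big1 // => b _; have [<-|ab] := eqVneq a b; first exact: x0.
exact: killing_homog_orth ab xa (uP b).
Qed.

(** For x in t orthogonal to t, the orthogonal of x contains t, and also
    (ad h)^k y for k large since (ad h)^k x = 0; hence it contains the whole
    component of degree 0, on which the form is nondegenerate. *)
Lemma killing_nondeg_cartan x : x \in t ->
  (forall y, y \in t -> killing x y = 0) -> x = 0.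
Proof.
move=> xt x0; have [n tn] := cartan_ad_nilpotent.
apply: (killing_nondeg_homog (cartan_sub0 xt)) => y.
pose M := lker (linfun (killing x : g -> F^o)).
suff /subvP/[apply] : (g0 <= M)%VS by rewrite memv_ker lfunE => /eqP.
apply: (cartan_complement (n := n)) => //.
  by apply/subvP => z zt; rewrite memv_ker lfunE /= x0.
move=> h z k ht z0 nk; rewrite memv_ker lfunE /= killing_iter_ad ?cartan_sub0 //.
rewrite -(subnK nk) iterD tn // (_ : iter _ _ 0 = 0) ?killing0l ?mulr0 //.
by elim: (k - n)%N => //= j ->; rewrite linear0.
Qed.

End Cartan.

(** * Commutativity and semisimplicity of the Cartan subalgebra *)

Lemma span_sum_sub (F : fieldType) (V : vectType F) (P : V -> Prop) (I : eqType)
    (s : seq I) (u : I -> V) :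
    (forall i, i \in s ->
      exists2 l : seq V, {in l, forall v, P v} & u i \in <<l>>%VS) ->
  exists2 l : seq V, {in l, forall v, P v} & \sum_(i <- s) u i \in <<l>>%VS.
Proof.
elim: s => [|i s IH] us; first by exists [::]; rewrite ?big_nil ?mem0v.
have [l1 l1P ul1] := us i (mem_head _ _).
have [j js|l2 l2P ul2] := IH; first by apply: us; rewrite inE js orbT.
exists (l1 ++ l2) => [v|]; first by rewrite mem_cat => /orP[/l1P|/l2P].
by rewrite big_cons span_cat memv_add.
Qed.

Section CartanSemisimple.
Variables (C : numClosedFieldType) (g : vectType C) (L : gradedLie g).
Variable t : {vspace g}.
Local Notation "[[ x , y ]]" := (bracket L x y).
Local Notation g0 := (homog L 0).
Local Notation ad := (ad L).
Local Notation killing := (killing L).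
Local Notation lcs k := (iter k (bracketv L t) t).
Hypothesis t_cartan : cartan_subalgebra L t.
Hypothesis K_nondeg : forall x, (forall y, killing x y = 0) -> x = 0.

(** An element u of the last nonzero term of the lower central series is central
    in t and is a sum of commutators, so that all positive powers of ad u are
    traceless and ad u composed with any commuting ad z is traceless too: u is orthogonal
    to t. *)
Lemma lcs_central_eq0 k : lcs k.+2 = 0%VS -> lcs k.+1 = 0%VS.
Proof.
move=> k2; apply/eqP; rewrite -subv0; apply/subvP => u uk; rewrite memv0; apply/eqP.
have ut := subvP (lcs_sub t_cartan k.+1) _ uk.
apply: (killing_nondeg_cartan t_cartan K_nondeg ut) => z zt.
have comm y : y \in t -> (ad y \o ad u = ad u \o ad y)%VF.
  move=> yt; apply/eqP; rewrite -subr_eq0 -ad_bracket0 ?(cartan_sub0 t_cartan) //.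
  have : [[y, u]] \in lcs k.+2 by apply: mem_bracketv.
  by rewrite k2 memv0 => /eqP->; rewrite linear0.
have commX y j : y \in t ->
    (ad y \o lfun_pow (ad u) j = lfun_pow (ad u) j \o ad y)%VF.
  move=> yt; elim: j => [|j IH]; first by rewrite comp_lfun1l comp_lfun1r.
  by rewrite /= comp_lfunA comm // -comp_lfunA IH comp_lfunA.
apply: (@lfun_trace_comp_eq0 _ _ _ _ 1) => [|j]; first by rewrite comm.
rewrite -/(ad_trace L (lfun_pow (ad u) j) u).
pose M := lker (linfun (ad_trace L (lfun_pow (ad u) j))).
apply/eqP; rewrite -[_ == 0](_ : u \in M = _).
  apply: subvP uk; apply: bracketv_sub => x y xt yk.
  by rewrite memv_ker lfunE /= ad_trace_bracket ?(cartan_sub0 t_cartan) ?commX.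
by rewrite memv_ker lfunE.
Qed.

Lemma cartan_abelian x y : x \in t -> y \in t -> [[x, y]] = 0.
Proof.
move=> xt yt; apply/eqP; rewrite -memv0.
have [n tn] : nilpotentv L t by case: t_cartan.
suff <- : lcs 1 = 0%VS by apply: mem_bracketv.
have : lcs n.+1 = 0%VS.
  apply/eqP; rewrite -subv0 iterS tn; apply: bracketv_sub => u v _.
  by rewrite memv0 => /eqP->; rewrite linear0r mem0v.
by elim: n {tn} => // n IH /lcs_central_eq0/IH.
Qed.

Lemma ad_cartan_comm x y : x \in t -> y \in t -> (ad x \o ad y = ad y \o ad x)%VF.
Proof.
move=> xt yt; apply/eqP; rewrite -subr_eq0 -ad_bracket0 ?(cartan_sub0 t_cartan) //.
by rewrite cartan_abelian // linear0.
Qed.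

Lemma ad_cartan_commE x y z : x \in t -> y \in t ->
  [[x, [[y, z]]]] = [[y, [[x, z]]]].
Proof. by move=> xt yt; rewrite -!adE -!comp_lfunE ad_cartan_comm. Qed.

(** Such a derivation E has tr (E ad y) = 0 for all y: for y in t because E ad y
    is nilpotent, for y = [h, z] because E commutes with ad h (these two kinds of
    y span g0), and for y of nonzero degree because E ad y shifts degrees.
    As K (E y, z) is the trace of E ad [y, z] for y and z of the same degree, E y
    is in the radical of K. *)
Lemma nilpotent_derivation_eq0 (E : 'End(g)) N :
    (forall x, iter N E x = 0) ->
    (forall x y, E [[x, y]] = [[E x, y]] + [[x, E y]]) ->
    (forall a x, x \in homog L a -> E x \in homog L a) ->
    (forall h, h \in t -> (E \o ad h = ad h \o E)%VF) ->
  E = 0.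
Proof.
move=> Enil Eder Ehom Et.
have adEE y : ad (E y) = ((E \o ad y) - (ad y \o E))%VF.
  apply/lfunP => z; rewrite add_lfunE opp_lfunE !comp_lfunE !adE Eder.
  by rewrite addrK.
have trE y : y \in g0 -> ad_trace L E y = 0.
  pose M := lker (linfun (ad_trace L E)).
  suff /subvP/[apply] : (g0 <= M)%VS by rewrite memv_ker lfunE => /eqP.
  have [n tn] := cartan_ad_nilpotent t_cartan.
  apply: (cartan_complement (n := n.+1) t_cartan).
  - apply/subvP => h ht; rewrite memv_ker lfunE /= /ad_trace lfun_trace_comp.
    rewrite (@lfun_trace_comp_eq0 _ _ _ _ N) ?Et // => k.
    rewrite (_ : lfun_pow _ _ = 0) ?linear0 //.
    apply/lfunP => x; rewrite lfun_powE addnC iterD Enil zero_lfunE.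
    by elim: k => //= k ->; rewrite linear0.
  - by move=> h x ht xt; rewrite iterS tn ?linear0.
  - move=> h x [//|k] ht x0 _; rewrite memv_ker lfunE /= adE.
    by rewrite ad_trace_bracket ?Et ?(cartan_sub0 t_cartan).
apply: (homog_lfunP (L := L)) => a y ya; rewrite zero_lfunE.
apply: (killing_nondeg_homog K_nondeg (Ehom _ _ ya)) => z za.
rewrite /killing adEE comp_lfunDl comp_lfunNl linearB /=.
rewrite -(trE _ (bracket_same_homog0 ya za)) /ad_trace (ad_bracket_same ya za).
rewrite comp_lfunDl comp_lfunNl linearB /= -!comp_lfunA.
congr (_ - _); first by rewrite [LHS]lfun_trace_comp -comp_lfunA.
by rewrite comp_lfunA [LHS]lfun_trace_comp.
Qed.

(** The semisimple part D of ad h is a polynomial in ad h, chosen by the Chinese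
   remainder theorem also at the sums of two eigenvalues so that D is a
   derivation. The nilpotent part ad h - D then vanishes. *)
Lemma cartan_ad_eigen_sum h : h \in t -> exists s : seq C,
  forall (U : {vspace g}) x, (forall y, y \in U -> [[h, y]] \in U) -> x \in U ->
    exists u : C -> g, [/\ x = \sum_(c <- s) u c, forall c, u c \in U &
      {in s, forall c, [[h, u c]] = c *: u c}].
Proof.
move=> ht; have [s [N us [N0 sN] ] ] := split_annihilator (ad h).
pose s' := undup (s ++ [seq c + d | c <- s, d <- s]).
have ss' c : c \in s -> c \in s' by rewrite mem_undup mem_cat => ->.
have ss'2 c d : c \in s -> d \in s -> c + d \in s'.
  move=> cs ds; rewrite mem_undup mem_cat; apply/orP; right.
  by apply/allpairsP; exists (c, d).
have [q qP] := poly_chinese (N + N) (fun c => c%:P) (undup_uniq _ : uniq s').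
pose D := lfun_horner (ad h) q; pose E := ad h - D.
have fullE x : exists u : C -> g, x = \sum_(c <- s) u c /\
    {in s, forall c, lfun_horner (ad h) (('X - c%:P) ^+ N) (u c) = 0}.
  have [|||u [xu _ uP] ] := @generalized_eigen_sum _ _ (ad h) s N fullv x us.
  - by move=> y _; rewrite memvf.
  - exact: memvf.
  - exact: sN.
  by exists u.
have DE c x : c \in s' -> lfun_horner (ad h) (('X - c%:P) ^+ (N + N)) x = 0 ->
    D x = c *: x.
  move=> cs' xc; apply/eqP; rewrite -subr_eq0 -(lfun_hornerC (ad h) c x).
  by rewrite -lfun_hornerBE (lfun_horner_dvd (qP c cs') xc).
have Dgen c x : c \in s -> lfun_horner (ad h) (('X - c%:P) ^+ N) x = 0 ->
    D x = c *: x.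
  move=> cs xc; apply: DE (ss' c cs) _; apply: lfun_horner_dvd xc.
  by rewrite dvdp_exp2l // leq_addr.
have Dder x y : D [[x, y]] = [[D x, y]] + [[x, D y]].
  have [u [-> uP] ] := fullE x; have [v [-> vP] ] := fullE y.
  rewrite (linear_sum D) !linear_sumlz (linear_sum D) -big_split.
  apply: eq_big_seq => c cs /=.
  rewrite (linear_sum D) !linear_sumr (linear_sum D) -big_split.
  apply: eq_big_seq => d ds /=.
  rewrite (Dgen c (u c)) ?uP // (Dgen d (v d)) ?vP //.
  rewrite linearZl_LR linearZr_LR /= -scalerDl.
  apply: (DE _ _ (ss'2 _ _ cs ds)); rewrite lfun_horner_gen.
  apply: iter_ad_bracket; rewrite ?(cartan_sub0 t_cartan) // -lfun_horner_gen.
    exact: uP.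
  exact: vP.
have EE x : E x = lfun_horner (ad h) ('X - q) x.
  by rewrite lfun_hornerBE lfun_hornerX add_lfunE opp_lfunE.
have E0 : E = 0.
  apply: (@nilpotent_derivation_eq0 _ N).
  - move=> x; rewrite (eq_iter EE) -lfun_hornerXn; have [u [-> uP] ] := fullE x.
    rewrite linear_sum big_seq big1 // => c cs; apply: lfun_horner_dvd (uP c cs).
    apply: dvdp_exp2r; have -> : 'X - q = ('X - c%:P) - (q - c%:P) by ring.
    rewrite dvdp_sub //; apply: dvdp_trans (qP c (ss' c cs)).
    by rewrite -{1}['X - c%:P]expr1 dvdp_exp2l // addn_gt0 N0.
  - move=> x y; rewrite !add_lfunE !opp_lfunE !adE.
    rewrite jacobi0 ?(cartan_sub0 t_cartan) //.
    by rewrite Dder linearBl linearBr /= opprD addrACA.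
  - move=> a x xa; rewrite EE; apply: lfun_horner_stable xa => y ya.
    by rewrite adE bracket_homog0 // (cartan_sub0 t_cartan).
  - move=> k kt; apply/lfunP => x; rewrite !comp_lfunE !EE.
    apply: lfun_horner_comm => y; rewrite !adE ad_cartan_commE //.
exists s => U x hU xU.
have [||u [xu uU uP] ] := @generalized_eigen_sum _ _ (ad h) s N U x us _ xU.
- by move=> y yU; rewrite adE hU.
- exact: sN.
exists u; split=> // c cs; rewrite -(Dgen c (u c) cs (uP c cs)) -adE.
by apply/eqP; rewrite -subr_eq0 -opp_lfunE -add_lfunE -/E E0 zero_lfunE.
Qed.

(** The eigenspaces of one ad h are stable under t because t is abelian; the
    general U makes the induction apply inside them. *)
Lemma cartan_joint_eigen_span (hs : seq g) (U : {vspace g}) x :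
    {subset hs <= t} -> (forall h y, h \in t -> y \in U -> [[h, y]] \in U) ->
    x \in U ->
  exists2 l : seq g, {in l, forall v, v \in U /\
      forall h, h \in hs -> exists c, [[h, v]] = c *: v} & x \in <<l>>%VS.
Proof.
elim: hs U x => [|h hs IH] U x hst tU xU.
  by exists [:: x]; [move=> v; rewrite inE => /eqP-> | rewrite memv_span ?mem_head].
have ht : h \in t by apply: hst; rewrite mem_head.
have [s sP] := cartan_ad_eigen_sum ht.
have [u [-> uU uP] ] := sP U x (fun y => tU h y ht) xU.
apply: span_sum_sub => c cs.
pose f := ad h - c *: \1%VF.
have fE y : (y \in lker f) = ([[h, y]] == c *: y).
  by rewrite memv_ker add_lfunE opp_lfunE scale_lfunE id_lfunE adE subr_eq0.
have [k ks|k y kt||l lP ul] := IH (U :&: lker f)%VS (u c).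
- by apply: hst; rewrite inE ks orbT.
- rewrite !memv_cap !fE => /andP[yU /eqP yc]; rewrite tU //=.
  by rewrite ad_cartan_commE // yc linearZr_LR.
- by rewrite memv_cap uU fE uP // eqxx.
exists l => // v /lP[]; rewrite memv_cap fE => /andP[vU /eqP vc] vhs; split=> // k.
by rewrite inE => /orP[/eqP->|/vhs//]; exists c.
Qed.

Local Notation tdual := 'Hom(subvs_of t, C^o).

(** Eigenvalues on a basis of t extend to a linear functional on t. *)
Lemma joint_eigen_weight v :
    (forall h, h \in vbasis t -> exists c, [[h, v]] = c *: v) ->
  exists w : tdual, forall h : subvs_of t, [[vsval h, v]] = w h *: v.
Proof.
move=> veig.
have /fin_all_exists[c cP] (i : 'I_(\dim t)) :
    exists c, [[(vbasis t)`_i, v]] = c *: v.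
  by apply: veig; rewrite mem_nth // size_tuple.
exists (\sum_i c i *: linfun (coord (vbasis t) i \o vsval : subvs_of t -> C^o)) => h.
rewrite {1}(coord_vbasis (subvsP h)) linear_sumlz sum_lfunE scaler_suml.
apply: eq_bigr => i _; rewrite linearZl_LR cP scale_lfunE lfunE /= scalerA.
by rewrite mulrC.
Qed.

(** The homogeneous components are stable under t, so that the common
    eigenvectors can be taken inside them. *)
Lemma weight_basis : exists (b : (\dim {:g}).-tuple g)
    (deg : 'I_(\dim {:g}) -> Z2Z2) (w : 'I_(\dim {:g}) -> tdual),
  [/\ basis_of fullv b, forall i : 'I_(\dim {:g}), b`_i \in homog L (deg i) &
      forall (i : 'I_(\dim {:g})) h, [[vsval h, b`_i]] = w i h *: b`_i].
Proof.
have [|b bb bP] := @spanning_basis _ g (fun v => (exists a, v \in homog L a) /\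
  exists w : tdual, forall h : subvs_of t, [[vsval h, v]] = w h *: v).
  move=> x; have [u uP ->] := homog_decomp L x.
  apply: span_sum_sub => a _.
  have [h|h y ht ya||l lP ul] :=
    @cartan_joint_eigen_span (vbasis t) (homog L a) (u a).
  - exact: vbasis_mem.
  - by rewrite bracket_homog0 ?(cartan_sub0 t_cartan).
  - exact: uP.
  exists l => // v /lP[va veig]; split; first by exists a.
  exact: joint_eigen_weight.
have bi (i : 'I_(\dim {:g})) : b`_i \in tval b by rewrite mem_nth ?size_tuple.
have /fin_all_exists[deg degP] := fun i => (bP _ (bi i)).1.
have /fin_all_exists[w wP] := fun i => (bP _ (bi i)).2.
by exists b, deg, w.
Qed.

End CartanSemisimple.

(** * Weights and strings *)

Section Weights.
Variables (C : numClosedFieldType) (g : vectType C) (L : gradedLie g).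
Variable t : {vspace g}.
Local Notation "[[ x , y ]]" := (bracket L x y).
Local Notation g0 := (homog L 0).
Local Notation ad := (ad L).
Local Notation killing := (killing L).
Local Notation tdual := 'Hom(subvs_of t, C^o).
Local Notation n := (\dim {:g}).
Implicit Types (alpha beta : tdual) (h : subvs_of t).

Hypothesis t_cartan : cartan_subalgebra L t.
Hypothesis K_nondeg : forall x, (forall y, killing x y = 0) -> x = 0.

Definition weight_vector alpha x := forall h, [[vsval h, x]] = alpha h *: x.

Lemma tdual_mulrnE alpha k h : (alpha *+ k) h = alpha h *+ k.
Proof. by elim: k => [|k IH]; rewrite ?zero_lfunE // !mulrS add_lfunE IH. Qed.

Lemma vsval_sub0 h : vsval h \in g0.
Proof. by apply: (cartan_sub0 t_cartan); apply: subvsP. Qed.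

Lemma weight_vector_bracket alpha beta x y :
  weight_vector alpha x -> weight_vector beta y ->
  weight_vector (alpha + beta) [[x, y]].
Proof.
move=> xa yb h; rewrite jacobi0 ?vsval_sub0 // xa yb linearZl_LR linearZr_LR.
by rewrite add_lfunE scalerDl.
Qed.

Lemma weight_vector_iter alpha beta x y k :
  weight_vector alpha x -> weight_vector beta y ->
  weight_vector (beta + alpha *+ k) (iter k (ad x) y).
Proof.
move=> xa yb; elim: k => [|k IH] /=; first by rewrite addr0.
by rewrite mulrS addrCA adE; apply: weight_vector_bracket.
Qed.

Lemma killing_nondeg_vsval h :
  (forall h', killing (vsval h) (vsval h') = 0) -> h = 0.
Proof.
move=> h0; apply: subvs_inj.
apply: (killing_nondeg_cartan t_cartan K_nondeg (subvsP h)).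
by move=> y yt; rewrite -(vsprojK yt) h0.
Qed.

(** The map from t to its dual given by the Killing form is injective, and both
    spaces have the same dimension. *)
Lemma dual_vector_exists alpha :
  exists H : subvs_of t, forall h, alpha h = killing (vsval H) (vsval h).
Proof.
pose Phi (H : subvs_of t) : tdual :=
  linfun (killing (vsval H) \o vsval : subvs_of t -> C^o).
have PhiE H h : Phi H h = killing (vsval H) (vsval h) by rewrite lfunE.
have Phi_lin : linear Phi.
  move=> c x y; apply/lfunP => h.
  by rewrite add_lfunE scale_lfunE !PhiE linearP killingDl killingZl.
pose PhiL := GRing.isSemilinear.Build C (subvs_of t) tdual *:%R Phi
  (GRing.semilinear_linear Phi_lin).
pose PhiF : {linear subvs_of t -> tdual} := HB.pack Phi PhiL.
have fE H : linfun PhiF H = Phi H by rewrite lfunE.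
have ker0 : lker (linfun PhiF) == 0%VS.
  rewrite -subv0; apply/subvP => H; rewrite memv_ker memv0 fE => /eqP H0.
  by apply/eqP/killing_nondeg_vsval => h; rewrite -PhiE H0 zero_lfunE.
have : limg (linfun PhiF) = fullv.
  apply/eqP; rewrite eqEdim subvf limg_dim_eq ?(eqP ker0) ?capv0 // !dimvf.
  exact: eq_leq (muln1 _).
move=> limgF; have := memvf alpha; rewrite -limgF => /memv_imgP[H _ ->].
by exists H => h; rewrite fE PhiE.
Qed.

Local Notation H_ alpha := (dual_vector L (alpha : tdual)).

Lemma dual_vectorE alpha h : alpha h = killing (vsval (H_ alpha)) (vsval h).
Proof.
have [H HP] := dual_vector_exists alpha.
exact: (@xgetPex _ 0 [set H : subvs_of t | forall H' : subvs_of t,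
  alpha H' = killing (vsval H) (vsval H')] (ex_intro _ H HP)).
Qed.

Lemma dual_vector_uniq alpha H :
  (forall h, alpha h = killing (vsval H) (vsval h)) -> H_ alpha = H.
Proof.
move=> HP; apply/eqP; rewrite -subr_eq0; apply/eqP/killing_nondeg_vsval => h.
by rewrite linearB killingBl -dual_vectorE HP subrr.
Qed.

Lemma dual_vector_linear c alpha beta :
  H_ (c *: alpha + beta) = c *: H_ alpha + H_ beta.
Proof.
apply: dual_vector_uniq => h.
by rewrite add_lfunE scale_lfunE !dual_vectorE linearP killingDl killingZl.
Qed.

Lemma dual_vector0 : H_ 0 = 0.
Proof. by apply: dual_vector_uniq => h; rewrite zero_lfunE linear0 killing0l. Qed.

Lemma dual_formE alpha beta : dual_form L alpha beta = alpha (H_ beta).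
Proof. by rewrite dual_vectorE. Qed.

Lemma dual_formC alpha beta : dual_form L alpha beta = dual_form L beta alpha.
Proof. exact: killingC. Qed.

Lemma dual_vectorN alpha : H_ (- alpha) = - H_ alpha.
Proof.
rewrite -[- alpha]addr0 -scaleN1r dual_vector_linear.
by rewrite dual_vector0 addr0 scaleN1r.
Qed.

Variables (b : n.-tuple g) (deg : 'I_n -> Z2Z2) (w : 'I_n -> tdual).
Hypothesis b_basis : basis_of fullv b.
Hypothesis b_homog : forall i : 'I_n, b`_i \in homog L (deg i).
Hypothesis b_weight : forall i : 'I_n, weight_vector (w i) b`_i.

Lemma coord_iter_ad h c k x (i : 'I_n) :
  coord b i (iter k (fun y => ad (vsval h) y - c *: y) x) =
    (w i h - c) ^+ k * coord b i x.
Proof.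
elim: k => [|k IH]; first by rewrite mul1r.
rewrite iterS linearB linearZ /= exprS -mulrA -IH mulrBl; congr (_ - _).
set y := iter _ _ _.
rewrite {1}(coord_basis b_basis (memvf y)) linear_sum linear_sum.
have adj (j : 'I_n) : coord b i (ad (vsval h) (coord b j y *: b`_j)) =
    coord b j y * (w j h * (j == i)%:R).
  rewrite [ad _ _]linearZ /= adE b_weight !linearZ /=.
  by rewrite coord_free ?(basis_free b_basis).
rewrite (bigD1 i) //= big1 ?addr0 => [|j ji].
  by rewrite adj eqxx mulr1 mulrC.
by rewrite adj (negPf ji) !mulr0.
Qed.

(** The operators ad h are diagonal in the basis b, so that generalized
    eigenvectors are eigenvectors. *)
Lemma root_space_coord alpha x (i : 'I_n) :
  root_space L alpha x -> coord b i x != 0 -> w i = alpha.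
Proof.
move=> xa xi; apply/lfunP => h; have [k [k0 xk] ] := xa h.
have := coord_iter_ad h (alpha h) k x i; rewrite xk linear0 => /esym/eqP.
by rewrite mulf_eq0 (negPf xi) orbF expf_eq0 k0 subr_eq0 => /eqP.
Qed.

Lemma weight_vector_root_space alpha x :
  weight_vector alpha x -> root_space L alpha x.
Proof. by move=> xa h; exists 1%N; split=> //=; rewrite adE xa subrr. Qed.

Lemma root_space_weight alpha x :
  root_space L alpha x -> x != 0 -> exists i, w i = alpha.
Proof.
move=> xa x0; suff [i xi] : exists i : 'I_n, coord b i x != 0.
  by exists i; apply: root_space_coord xi.
apply/existsP; apply: contraNT x0; rewrite negb_exists => /forallP x0.
rewrite (coord_basis b_basis (memvf x)) big1 // => i _.
by rewrite (eqP (negPn (x0 i))) scale0r.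
Qed.

Lemma generalized_rootsP alpha :
  generalized_roots L t alpha <-> alpha != 0 /\ exists i, w i = alpha.
Proof.
split=> -[a0]; first by move=> [x [xa x0] ]; split=> //; apply: root_space_weight x0.
move=> [i wi]; split=> //; exists b`_i; split.
  by rewrite -wi; apply: weight_vector_root_space.
by rewrite (basis_not0 b_basis) // mem_nth ?size_tuple.
Qed.

Lemma killing_weights h h' :
  killing (vsval h) (vsval h') = \sum_i w i h * w i h'.
Proof.
rewrite /killing (lfun_trace_basis _ b_basis); apply: eq_bigr => i _.
rewrite comp_lfunE !adE b_weight linearZr_LR b_weight !linearZ /=.
by rewrite coord_free ?(basis_free b_basis) // eqxx mulr1 mulrC.
Qed.

(** Evaluate the Killing form on t as the sum of the squares of the weights,
    with H_alpha as first argument. *)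
Lemma weight_expansion alpha : alpha = \sum_i alpha (H_ (w i)) *: w i.
Proof.
apply/lfunP => h; rewrite sum_lfunE dual_vectorE killing_weights.
apply: eq_bigr => i _; rewrite scale_lfunE; congr (_ * _).
by rewrite !dual_vectorE killingC.
Qed.

Lemma killing_basis_opp (i j : 'I_n) : killing b`_i b`_j != 0 ->
  deg i = deg j /\ w j = - w i.
Proof.
move=> Kij; split.
  apply/eqP; apply: contraNT Kij => dij.
  by rewrite (killing_homog_orth dij (b_homog i) (b_homog j)).
apply/lfunP => h; rewrite opp_lfunE.
have := killing_invariant b`_i b`_j (vsval_sub0 h).
rewrite !b_weight killingZl killingZr -mulNr => /(mulIf Kij) ->.
by rewrite opprK.
Qed.

Lemma weight_partner (i : 'I_n) : exists j : 'I_n, killing b`_i b`_j != 0.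
Proof.
apply/existsP; have := basis_not0 b_basis (mem_nth 0 _ : b`_i \in _).
rewrite size_tuple => /(_ (ltn_ord i)); apply: contraNT.
rewrite negb_exists => /forallP K0; apply/eqP/K_nondeg => y.
rewrite (coord_basis b_basis (memvf y)) killing_sumr big1 // => j _.
by rewrite killingZr (eqP (negPn (K0 j))) mulr0.
Qed.

Lemma weight_opp i : exists j, w j = - w i.
Proof. by have [j /killing_basis_opp[_ wj] ] := weight_partner i; exists j. Qed.

(** With H = [e, f] and p = alpha (H), these are the relations of sl_2 up to
    scaling when p is nonzero, and those of a Heisenberg algebra when p = 0. *)
Lemma weight_triple i : exists a e f,
  [/\ e \in homog L a, f \in homog L a, weight_vector (w i) e,
      weight_vector (- w i) f & [[e, f]] = vsval (H_ (w i))].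
Proof.
have [j Kij] := weight_partner i.
have [dij wij] := killing_basis_opp Kij.
exists (deg i), b`_i, ((killing b`_i b`_j)^-1 *: b`_j).
set f := _ *: _; have fa : f \in homog L (deg i) by rewrite memvZ // dij.
have fw : weight_vector (- w i) f.
  by move=> h; rewrite /f linearZr_LR b_weight wij /= !scalerA mulrC.
have Kf : killing b`_i f = 1 by rewrite /f killingZr mulVf.
split=> //.
have eft : [[b`_i, f]] \in t.
  apply: (cartan_normalizer t_cartan) => [|h ht].
    exact: (bracket_same_homog0 (b_homog i)).
  rewrite -(vsprojK ht) (weight_vector_bracket (b_weight i) fw) subrr zero_lfunE.
  by rewrite scale0r mem0v.
rewrite -(vsprojK eft); congr vsval; symmetry; apply: dual_vector_uniq => h.
rewrite vsprojK // (killing_bracket_same (b_homog i) fa (vsval_sub0 h)).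
by rewrite b_weight killingZl Kf mulr1.
Qed.

(** In characteristic 0 the elements beta + k alpha are distinct, and there are
    only finitely many weights. *)
Lemma weight_string_finite alpha beta : alpha != 0 ->
  exists k, forall i, w i != beta + alpha *+ k.
Proof.
move=> a0; apply/not_existsP => noweight.
have /fin_all_exists[f fP] (k : 'I_n.+1) : exists i, w i = beta + alpha *+ k.
  by have /existsNP[i /negP/negPn/eqP] := noweight k; exists i.
have f_inj : injective f.
  move=> k l fkl; have := fP k; rewrite fkl fP => /addrI/eqP.
  rewrite -!scaler_nat -subr_eq0 -scalerBl scaler_eq0 (negPf a0) orbF.
  by rewrite subr_eq0 eqr_nat => /eqP/val_inj.
by have := leq_card f f_inj; rewrite !card_ord ltnn.
Qed.

Lemma ad_weight_nilpotent alpha beta x y : alpha != 0 ->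
    weight_vector alpha x -> weight_vector beta y -> y != 0 ->
  exists k, iter k (ad x) y != 0 /\ ad x (iter k (ad x) y) = 0.
Proof.
move=> a0 xa yb y0; have [k kP] := weight_string_finite beta a0.
have xk : exists k, iter k (ad x) y == 0.
  exists k; apply/negPn/negP => xk.
  have [i wi] := root_space_weight (weight_vector_root_space
    (weight_vector_iter k xa yb)) xk.
  by have := kP i; rewrite wi eqxx.
case: (ex_minnP xk) => -[|m] /eqP xm mmin; first by rewrite [y]xm eqxx in y0.
by exists m; split=> //; apply/negP => /mmin; rewrite ltnn.
Qed.

(** From a vector of weight w l climb k steps with e up to a vector u killed by e,
    then go down with f: [e, f^(j+1) u] is (j+1) (mu - j p/2) f^j u, where
    p = w i (H) and mu is the eigenvalue of H on u. If f^m u is the last nonzero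
    vector of the descent then mu = m p/2, while mu = w l (H) + k p. *)
Lemma weight_string i l : w i != 0 -> exists k m : nat,
  2 * w l (H_ (w i)) = (m%:R - 2 * k%:R) * w i (H_ (w i)) /\
  forall j, (j <= m)%N -> exists i', w i' = w l + w i *+ k - w i *+ j.
Proof.
move=> wi0; have [a [e [f [ea fa ew fw ef] ] ] ] := weight_triple i.
set H := H_ (w i) in ef *; set p := w i H.
have bl0 : b`_l != 0 by rewrite (basis_not0 b_basis) // mem_nth ?size_tuple.
have [k [u0 eu] ] := ad_weight_nilpotent wi0 ew (b_weight l) bl0.
set u := iter k _ _ in u0 eu.
have uw : weight_vector _ u := weight_vector_iter k ew (b_weight l).
set beta := w l + _ in uw; have nwi0 : - w i != 0 by rewrite oppr_eq0.
have [m [m0 fm] ] := ad_weight_nilpotent nwi0 fw uw u0.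
exists k, m; split; last first.
  move=> j jm; apply: (@root_space_weight _ (iter j (ad f) u)).
    rewrite -mulNrn; apply: weight_vector_root_space.
    exact: weight_vector_iter.
  apply: contraNneq m0 => uj; rewrite -(subnK jm) iterD uj.
  by elim: (m - j)%N => //= d /eqP->; rewrite linear0.
have fHu j : [[vsval H, iter j (ad f) u]] = (beta H - p *+ j) *: iter j (ad f) u.
  rewrite (weight_vector_iter j fw uw) add_lfunE mulNrn opp_lfunE.
  by rewrite tdual_mulrnE.
have efu j : 2 *: [[e, iter j.+1 (ad f) u]] =
    (j.+1%:R * (2 * beta H - j%:R * p)) *: iter j (ad f) u.
  elim: j => [|j IH].
    rewrite /= adE (bracket_jacobi _ ea fa) sgn_formxx expr0 scale1r ef.
    rewrite -(adE L e u) eu linear0r addr0 (fHu 0%N) scalerA.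
    by congr (_ *: _); ring.
  rewrite iterS adE (bracket_jacobi _ ea fa) sgn_formxx expr0 scale1r ef scalerDr.
  rewrite (fHu j.+1) -[X in _ + X]linearZr_LR IH linearZr_LR /= -(adE L f).
  rewrite !scalerA -scalerDl.
  by congr (_ *: _); rewrite -!natr1; ring.
have := efu m; rewrite iterS fm linear0r scaler0 => /esym/eqP.
rewrite scaler_eq0 (negPf m0) orbF mulf_eq0 pnatr_eq0 /= subr_eq0 => /eqP.
rewrite add_lfunE tdual_mulrnE -/p => E.
by rewrite mulrBl -E -mulr_natr; ring.
Qed.

(** If alpha (H_alpha) = 0, the relation for strings makes H_alpha vanish under
    every weight, so H_alpha is orthogonal to t. *)
Lemma weight_anisotropic i : w i != 0 -> w i (H_ (w i)) != 0.
Proof.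
move=> wi0; apply/negP => /eqP p0; move/eqP: (wi0); apply; apply/lfunP => h.
rewrite zero_lfunE dual_vectorE killing_weights big1 // => l _.
have [k [m [E _] ] ] := weight_string l wi0; move/eqP: E.
by rewrite p0 mulr0 mulf_eq0 pnatr_eq0 /= => /eqP->; rewrite mul0r.
Qed.

(** The integer is N = m - 2 k. When k <= m the descent reaches the reflected
    weight after m - k steps; otherwise N is negative and the string of the
    opposite root, which gives - N, takes over. *)
Lemma weight_reflection i l : w i != 0 -> exists N : int,
  2 * w l (H_ (w i)) = N%:~R * w i (H_ (w i)) /\
  exists i', w i' = w l - N%:~R *: w i.
Proof.
move=> wi0; have [k [m [E str] ] ] := weight_string l wi0.
have natint (p q : nat) : ((p%:Z - 2 * q%:Z)%:~R : C) = p%:R - 2 * q%:R.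
  by rewrite rmorphB rmorphM.
have [km|mk] := leqP k m.
  exists (m%:Z - 2 * k%:Z); rewrite natint; split=> //.
  have [i' wi'] := str (m - k)%N (leq_subr _ _); exists i'; rewrite wi'.
  rewrite -!scaler_nat natrB // -addrA -scalerBl -scaleNr; congr (_ + _ *: _).
  by ring.
have [j wj] := weight_opp i; have wj0 : w j != 0 by rewrite wj oppr_eq0.
have [k' [m' [E' str'] ] ] := weight_string l wj0.
rewrite wj dual_vectorN opp_lfunE !linearN opprK mulrN in E'.
have [km'|mk'] := leqP k' m'.
  exists (- (m'%:Z - 2 * k'%:Z)); rewrite rmorphN /= natint; split.
    by rewrite mulNr -E' opprK.
  have [i' wi'] := str' (m' - k')%N (leq_subr _ _); exists i'; rewrite wi'.
  rewrite wj -!scaler_nat natrB // -addrA -scalerBl scalerN -scaleNr -scaleNr.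
  by congr (_ + _ *: _); ring.
have /eqP : (m%:R - 2 * k%:R + (m'%:R - 2 * k'%:R)) * w i (H_ (w i)) = 0.
  by rewrite mulrDl -E -E' subrr.
rewrite mulf_eq0 (negPf (weight_anisotropic wi0)) orbF addrACA -opprD -mulrDr.
rewrite -!natrD -natrM subr_eq0 eqr_nat => /eqP mk2.
have : (m + m' < k + k')%N by rewrite -addnS leq_add // ltnW.
by rewrite mk2 mul2n -addnn -ltn_subRL subnn.
Qed.

(** With 2 w_l(H) = N_l p and p = sum_l w_l(H)^2 one gets 4 = p sum_l N_l^2. *)
Lemma weight_real i l : w l (H_ (w i)) \is Num.real.
Proof.
have [wi0|wi0] := eqVneq (w i) 0; first by rewrite wi0 dual_vector0 linear0 real0.
set p := w i (H_ (w i)); have p0 : p != 0 := weight_anisotropic wi0.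
have /fin_all_exists[N NP] k : exists N : int, 2 * w k (H_ (w i)) = N%:~R * p.
  by have [N [] ] := weight_reflection k wi0; exists N.
have two0 : (2 : C) != 0 by rewrite pnatr_eq0.
have wE k : w k (H_ (w i)) = (N k)%:~R * p / 2 by rewrite -NP mulrC mulKf.
suff pR : p \is Num.real by rewrite wE !realM ?realV ?realz ?realn.
have pE : p = p ^+ 2 * (\sum_k ((N k)%:~R / 2) ^+ 2).
  rewrite {1}/p dual_vectorE killing_weights mulr_sumr; apply: eq_bigr => k _.
  by rewrite wE; field.
have : 1 = p * (\sum_k ((N k)%:~R / 2) ^+ 2).
  by apply: (mulfI p0); rewrite mulr1 mulrA -expr2 -pE.
move=> pS; rewrite -[p]invrK realV (_ : p^-1 = \sum_k ((N k)%:~R / 2) ^+ 2).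
  by apply: sum_real => k _; rewrite realX // realM ?realV ?realz ?realn.
by apply: (mulfI p0); rewrite -pS mulfV.
Qed.

Lemma dual_form_weights alpha beta :
  dual_form L alpha beta = \sum_i alpha (H_ (w i)) * beta (H_ (w i)).
Proof.
rewrite dual_formE {1}[alpha]weight_expansion sum_lfunE; apply: eq_bigr => i _.
rewrite scale_lfunE; congr (_ * _).
by rewrite -dual_formE dual_formC dual_formE.
Qed.

Lemma dual_form_linear_l c alpha beta gamma :
  dual_form L (c *: alpha + beta) gamma =
    c * dual_form L alpha gamma + dual_form L beta gamma.
Proof. by rewrite !dual_formE add_lfunE scale_lfunE. Qed.

Lemma weight_coord_inj alpha beta :
  (forall i, alpha (H_ (w i)) = beta (H_ (w i))) -> alpha = beta.
Proof.
move=> ab; apply: etrans (weight_expansion alpha) _.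
by rewrite [RHS]weight_expansion; apply: eq_bigr => i _; rewrite ab.
Qed.

End Weights.

(** * The real form and the root system *)

Section SpanSet.
Variables (R : realType) (V : vectType R).

Lemma span_set_sub (S E : set V) :
  real_subspace E -> S `<=` E -> span_set V S `<=` E.
Proof.
move=> [E0 EP] SE v [s [sS vs]].
rewrite (coord_span (X := in_tuple s) vs) /=.
elim/big_rec: _ => // i x _ Ex; apply: EP => //.
by apply/SE/sS; rewrite mem_nth.
Qed.
End SpanSet.

Section RootSystem.
Variables (R : realType) (g : vectType R[i]) (L : gradedLie g).
Variable t : {vspace g}.
Local Notation C := R[i].
Local Notation tdual := 'Hom(subvs_of t, R[i]^o).
Local Notation rdual := (realification tdual).
Local Notation n := (\dim {:g}).
Local Notation H_ alpha := (dual_vector L (alpha : tdual)).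

Hypothesis t_cartan : cartan_subalgebra L t.
Hypothesis K_nondeg : forall x, (forall y, killing L x y = 0) -> x = 0.
Variables (b : n.-tuple g) (deg : 'I_n -> Z2Z2) (w : 'I_n -> tdual).
Hypothesis b_basis : basis_of fullv b.
Hypothesis b_homog : forall i : 'I_n, b`_i \in homog L (deg i).
Hypothesis b_weight : forall i : 'I_n, weight_vector L (w i) b`_i.

Let rootsP := generalized_rootsP b_basis b_weight.
Let wreal := weight_real t_cartan K_nondeg b_basis b_homog b_weight.
Let dformE := dual_form_weights t_cartan K_nondeg b_basis b_weight.
Let coord_inj := weight_coord_inj t_cartan K_nondeg b_basis b_weight.
Let reflection :=
  weight_reflection t_cartan K_nondeg b_basis b_homog b_weight.
Let anisotropic :=
  weight_anisotropic t_cartan K_nondeg b_basis b_homog b_weight.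
Let expansion := weight_expansion t_cartan K_nondeg b_basis b_weight.

(** The numbers phi (H_(w i)) are the coefficients of phi in its expansion along
    the weights, so this identifies the functionals real on t0 with the real
    combinations of weights. *)
Lemma t0_dualP (phi : tdual) :
  t0_dual L t phi <-> forall i, phi (H_ (w i)) \is Num.real.
Proof.
split=> [phiP i|phiP h].
  have [wi0|wi0] := eqVneq (w i) 0.
    by rewrite wi0 (dual_vector0 t_cartan K_nondeg) linear0 real0.
  apply: phiP; exists [:: (H_ (w i) : realification (subvs_of t))].
  split; last by rewrite memv_span ?mem_head.
  move=> u; rewrite inE => /eqP->; exists (w i) => //.
  by apply/rootsP; split=> //; exists i.
apply: (@span_set_sub R (realification (subvs_of t)) _ [set h | phi h \is Num.real]).
  split=> [|c x y /= xr yr]; first by rewrite /= linear0 real0.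
  have -> : phi (c *: x + y) = c%:C * phi x + phi y := linearP phi _ _ _.
  by rewrite realD ?realM //; apply/complex_realP; exists c.
by move=> _ [alpha /rootsP[_ [i <-] ] <-] /=.
Qed.

Lemma t0_dual_weight i : t0_dual L t (w i).
Proof. by apply/t0_dualP => j; apply: wreal. Qed.

Lemma t0_dual_subspace : real_subspace (t0_dual L t).
Proof.
split=> [|c x y /t0_dualP xr /t0_dualP yr].
  by move=> h _; rewrite zero_lfunE real0.
apply/t0_dualP => i.
have -> : (c *: x + y) (H_ (w i)) = c%:C * x (H_ (w i)) + y (H_ (w i)) :> C.
  by rewrite add_lfunE scale_lfunE.
by rewrite realD ?realM //; apply/complex_realP; exists c.
Qed.

Definition weight_combination (r : 'I_n -> R) : tdual := \sum_i (r i)%:C *: w i.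

Lemma weight_combinationE r h :
  weight_combination r h = \sum_i (r i)%:C * w i h :> C.
Proof. by rewrite sum_lfunE; apply: eq_bigr => i _; rewrite scale_lfunE. Qed.

Lemma t0_dual_combination r : t0_dual L t (weight_combination r).
Proof.
apply/t0_dualP => j; rewrite weight_combinationE; apply: sum_real => i _.
by rewrite realM ?wreal //; apply/complex_realP; exists (r i).
Qed.

Lemma weight_combination_ReIm (v : tdual) :
  v = weight_combination (fun i => complex.Re (v (H_ (w i)))) +
      'i%C *: weight_combination (fun i => complex.Im (v (H_ (w i)))).
Proof.
apply: etrans (expansion v) _.
rewrite scaler_sumr -big_split; apply: eq_bigr => i _ /=.
by rewrite scalerA -scalerDl -complexE.
Qed.

Lemma real_pair_inj (x y x' y' : C) :
    x \is Num.real -> y \is Num.real -> x' \is Num.real -> y' \is Num.real ->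
  x + 'i%C * y = x' + 'i%C * y' -> x = x' /\ y = y'.
Proof.
move=> /complex_realP[a ->] /complex_realP[c ->].
move=> /complex_realP[a' ->] /complex_realP[c' ->].
by move=> [] /=; rewrite !(mul0r, mul1r, mulr0, subr0, addr0, add0r) => -> ->.
Qed.

Lemma t0_dual_real_form : real_form (t0_dual L t).
Proof.
split=> [|v]; first exact: t0_dual_subspace.
exists (weight_combination (fun i => complex.Re (v (H_ (w i)))),
        weight_combination (fun i => complex.Im (v (H_ (w i))))); split=> /=.
  split; [exact: t0_dual_combination | exact: t0_dual_combination |].
  exact: weight_combination_ReIm.
move=> [x y] [/= xE yE vxy].
set x' := weight_combination _; set y' := weight_combination _.
have xy i : x' (H_ (w i)) = x (H_ (w i)) /\ y' (H_ (w i)) = y (H_ (w i)).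
  have [x'r y'r] : x' (H_ (w i)) \is Num.real /\ y' (H_ (w i)) \is Num.real.
    by split; apply: (iffLR (t0_dualP _)) (t0_dual_combination _) i.
  move/t0_dualP: xE => /(_ i) xr; move/t0_dualP: yE => /(_ i) yr.
  apply: real_pair_inj => //.
  have := congr1 (fun f : tdual => f (H_ (w i))) (weight_combination_ReIm v).
  by rewrite {1}vxy !add_lfunE !scale_lfunE => ->.
by congr (_, _); apply: coord_inj => i; have [] := xy i.
Qed.

Lemma dual_form_real alpha beta : t0_dual L t alpha -> t0_dual L t beta ->
  dual_form L alpha beta \is Num.real.
Proof.
move=> /t0_dualP ar /t0_dualP br; rewrite dformE.
by apply: sum_real => i _; rewrite realM.
Qed.

Lemma dual_form_inner_product :
  real_inner_product_space (t0_dual L t) (re_dual_form L t).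
Proof.
split; first exact: t0_dual_subspace.
- move=> c x y z _ _ _; rewrite /re_dual_form.
  have -> : dual_form L (c *: x + y : rdual) z =
      c%:C * dual_form L x z + dual_form L y z.
    exact: (dual_form_linear_l t_cartan K_nondeg).
  by rewrite raddfD /=; case: (dual_form L x z) => u v /=; rewrite mul0r subr0.
- by move=> x y _ _; rewrite /re_dual_form dual_formC.
- move=> x /t0_dualP xr x0.
  suff : 0 < dual_form L x x by rewrite ltcE => /andP[].
  rewrite dformE lt_neqAle eq_sym sumr_ge0 ?andbT => [|i _]; last first.
    by rewrite -expr2 real_exprn_even_ge0.
  apply: contraNneq x0 => /eqP; rewrite psumr_eq0 => [|i _]; last first.
    by rewrite -expr2 real_exprn_even_ge0.
  move=> /allP x0; apply/eqP; apply: coord_inj => i.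
  have := x0 i (mem_index_enum _); rewrite mulf_eq0 orbb => /eqP ->.
  by rewrite zero_lfunE.
Qed.

Lemma re_cartan_integer i l (N : int) : w i != 0 ->
    2 * w l (H_ (w i)) = N%:~R * w i (H_ (w i)) ->
  2 * (re_dual_form L t (w l) (w i) / re_dual_form L t (w i) (w i)) = N%:~R :> R.
Proof.
move=> wi0; rewrite /re_dual_form !(dual_formE t_cartan K_nondeg).
have := anisotropic wi0.
have /complex_realP[c ->] := wreal i l; have /complex_realP[p ->] := wreal i i.
rewrite -[0]/(0%:C) -[2]/(2%:R) -(rmorph_nat (real_complex R)).
rewrite -(rmorph_int (real_complex R)) -!rmorphM => p0 /complexI E.
have {}p0 : p != 0 by apply: contra_neq p0 => ->.
by rewrite mulrA E mulfK.
Qed.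

Lemma roots_abstract_root_system :
  abstract_root_system (t0_dual L t) (re_dual_form L t) (generalized_roots L t).
Proof.
split.
- split; last by case=> /eqP.
  apply: (@sub_finite_set _ _ [set` codom w]); last exact: finite_seq.
  by move=> alpha /rootsP[_ [i <-] ]; apply: codom_f.
- apply/seteqP; split.
    apply: span_set_sub; first exact: t0_dual_subspace.
    by move=> alpha /rootsP[_ [i <-] ]; apply: t0_dual_weight.
  move=> phi /t0_dualP phir.
  pose s : seq tdual := [seq w i | i <- enum 'I_n & w i != 0].
  have sP (u : tdual) : u \in s -> generalized_roots L t u.
    case/mapP=> i; rewrite mem_filter => /andP[wi0 _] ->.
    by apply/rootsP; split=> //; exists i.
  exists s; split; first exact: sP.
  have -> : phi = \sum_i complex.Re ((phi : tdual) (H_ (w i))) *: (w i : rdual).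
    apply: etrans (expansion (phi : tdual)) _; apply: eq_bigr => i _.
    by rewrite realification_scaleE RRe_real.
  apply: rpred_sum => i _.
  have [->|wi0] := eqVneq (w i) 0; first by rewrite scaler0 mem0v.
  apply: memvZ; apply: memv_span.
  suff : w i \in s by [].
  by apply: map_f; rewrite mem_filter wi0 mem_enum.
- move=> alpha beta /rootsP[wi0 [i wi] ] /rootsP[wl0 [l wl] ]; subst alpha beta.
  have [N [NE [j wj] ] ] := reflection l wi0.
  rewrite (re_cartan_integer wi0 NE).
  have -> : (w l : rdual) - (N%:~R : R) *: (w i : rdual) = w j.
    by rewrite wj realification_scaleE rmorph_int.
  apply/rootsP; split; last by exists j.
  apply: contraNneq wl0; rewrite wj => /eqP; rewrite subr_eq0 => /eqP wlE.
  move/eqP: NE; rewrite wlE scale_lfunE /= -subr_eq0.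
  rewrite (_ : _ - _ = N%:~R * w i (H_ (w i))).
    2: by rewrite /GRing.scale /=; ring.
  rewrite mulf_eq0 (negPf (anisotropic wi0)).
  by rewrite orbF => /eqP->; rewrite scale0r.
- move=> alpha beta /rootsP[wi0 [i wi] ] /rootsP[_ [l wl] ]; subst alpha beta.
  have [N [NE _] ] := reflection l wi0.
  by rewrite (re_cartan_integer wi0 NE) intr_int.
Qed.

End RootSystem.

Theorem corollary2p12 (R : realType) (g : vectType R[i]) (L : gradedLie g)
    (t : {vspace g}) :
  basic L -> simple_graded L -> cartan_subalgebra L t ->
  [/\ real_form (t0_dual L t),
      forall alpha beta, t0_dual L t alpha -> t0_dual L t beta ->
        dual_form L alpha beta \is Num.real,
      real_inner_product_space (t0_dual L t) (re_dual_form L t) &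
      abstract_root_system (t0_dual L t) (re_dual_form L t)
        (generalized_roots L t)].
Proof.
move=> [K_nondeg _] _ t_cartan.
have [b [deg [w [b_basis b_homog b_weight] ] ] ] := weight_basis t_cartan K_nondeg.
split.
- exact: t0_dual_real_form b_weight.
- by move=> alpha beta; exact: (dual_form_real t_cartan K_nondeg b_basis b_weight).
- exact: dual_form_inner_product b_weight.
- exact: roots_abstract_root_system b_weight.
Qed.
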